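(* Let $d\in\mathbb{N}$, let $\alpha>1/2$ be a real number and let $\boldsymbol{\gamma}=(\gamma_1,\gamma_2,\ldots)$ be a sequence of real numbers with $0\le \gamma_j\le 1$ for all $j$. Let $r,M\in\mathbb{N}$ with $M\ge 2$. Assume that $M$ and $\eta\in(0,1)$ satisfy $$(1-\eta)M \;\ge\; \inf_{1/2\le \lambda<\alpha}\, 2\prod_{j=1}^{d}\left(1+2\gamma_j^{1/\lambda}\zeta(\alpha/\lambda)\right).$$ Then for any $1/2\le\lambda<\alpha$ and $0<\delta\le 1/\alpha$, $$\left(e^{\mathrm{rms}}(H_{\alpha,\boldsymbol{\gamma}};\tilde A^{\mathrm{ran}}_{r,M})\right)^2\le \frac{r\,C_{\lambda,\delta}}{\alpha(1-\eta)^{\lambda(2-\delta)}M^{\lambda(2-\delta)+1}}\prod_{j=1}^{d}\left(1+2\gamma_j^{1/\lambda}\zeta(\alpha/\lambda)\right)^{\lambda(2-\delta)}+(1-\eta)^r,$$ where $C_{\lambda,\delta}$ is a positive constant depending only on $\lambda$ and $\delta$.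
   Context: $\zeta$ is the Riemann zeta function. Weighted Korobov space. For $\boldsymbol{k}\in\mathbb{Z}^d$ let $r_{\alpha,\boldsymbol{\gamma}}(\boldsymbol{k})=\prod_{j:\,k_j\neq 0}|k_j|^{\alpha}/\gamma_j$ (empty product $=1$; $|k_j|^\alpha/\gamma_j=\infty$ if $\gamma_j=0$; $1/\infty=0$, $\infty\cdot 0=0$). For $\alpha>1/2$, $H_{\alpha,\boldsymbol{\gamma}}$ is the space of functions $f:[0,1]^d\to\mathbb{R}$, one-periodic in each variable, with absolutely convergent Fourier series $f(\boldsymbol{x})=\sum_{\boldsymbol{k}\in\mathbb{Z}^d}\hat f(\boldsymbol{k})e^{2\pi i\boldsymbol{k}\cdot\boldsymbol{x}}$, where $\hat f(\boldsymbol{k})=\int_{[0,1]^d}f(\boldsymbol{x})e^{-2\pi i\boldsymbol{k}\cdot\boldsymbol{x}}\,d\boldsymbol{x}$, such that $\hat f(\boldsymbol{k})=0$ whenever $r_{\alpha,\boldsymbol{\gamma}}(\boldsymbol{k})=\infty$ and $\|f\|_{\alpha,\boldsymbol{\gamma}}^2=\sum_{\boldsymbol{k}}|\hat f(\boldsymbol{k})|^2 r_{\alpha,\boldsymbol{\gamma}}(\boldsymbol{k})^2<\infty$. Lattice rules. $I(f)=\int_{[0,1]^d}f(\boldsymbol{x})\,d\boldsymbol{x}$. For $N\ge 2$ and $\boldsymbol{z}\in\{1,\ldots,N-1\}^d$, the rank-1 lattice point set is $P_{N,\boldsymbol{z}}=\{(\{nz_1/N\},\ldots,\{nz_d/N\}):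 0\le n<N\}$, with $\{x\}=x-\lfloor x\rfloor$. For $\boldsymbol{\Delta}\in[0,1]^d$, $P_{N,\boldsymbol{z}}+\boldsymbol{\Delta}=\{(\{x_1+\Delta_1\},\ldots,\{x_d+\Delta_d\}):\boldsymbol{x}\in P_{N,\boldsymbol{z}}\}$. For an $N$-element point set $P$, $Q_P(f)=\frac1N\sum_{\boldsymbol{x}\in P}f(\boldsymbol{x})$, and the worst-case error is $e^{\mathrm{wor}}(H_{\alpha,\boldsymbol{\gamma}};Q_P)=\sup_{\|f\|_{\alpha,\boldsymbol{\gamma}}\le 1}|I(f)-Q_P(f)|$. Algorithm (inputs $\alpha,\boldsymbol{\gamma},r,M$): (1) draw $N$ uniformly from $\mathcal{P}_M=\{p \text{ prime}: \lceil M/2\rceil<p\le M\}$; (2) given $N$, draw $\boldsymbol{z}_1,\ldots,\boldsymbol{z}_r$ independently and uniformly from $\{1,\ldots,N-1\}^d$; (3) let $\boldsymbol{z}^*$ be a vector among $\boldsymbol{z}_1,\ldots,\boldsymbol{z}_r$ minimizing $e^{\mathrm{wor}}(H_{\alpha,\boldsymbol{\gamma}};Q_{P_{N,\boldsymbol{z}_j}})$ (ties broken by any fixed rule). The randomly shifted rule $\tilde A^{\mathrm{ran}}_{r,M}$ is the random rule $Q_{P_{N,\boldsymbol{z}^*}+\boldsymbol{\Delta}}$, where $\boldsymbol{\Delta}$ is uniform on $[0,1]^d$ and independent of $N,\boldsymbol{z}_1,\ldots,\boldsymbol{z}_r$. Its worst-case root-mean-squared error is $$e^{\mathrm{rms}}(H_{\alpha,\boldsymbol{\gamma}};\tilde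 A^{\mathrm{ran}}_{r,M})=\sup_{f\in H_{\alpha,\boldsymbol{\gamma}},\ \|f\|_{\alpha,\boldsymbol{\gamma}}\le 1}\left(\mathbb{E}_{N,\boldsymbol{z}_1,\ldots,\boldsymbol{z}_r,\boldsymbol{\Delta}}\left[|I(f)-Q_{P_{N,\boldsymbol{z}^*}+\boldsymbol{\Delta}}(f)|^2\right]\right)^{1/2}.$$ *)

(* Defs.v *)
From HB Require Import structures.
From mathcomp Require Import all_boot all_order all_algebra.
From mathcomp Require Import finmap complex.
From mathcomp Require Import all_classical all_reals all_analysis.
From mathcomp Require summability.

Set Implicit Arguments.
Unset Strict Implicit.
Unset Printing Implicit Defensive.

Import Order.TTheory GRing.Theory Num.Theory.
Import numFieldNormedType.Exports.

Local Open Scope classical_set_scope.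
Local Open Scope ring_scope.
Local Open Scope complex_scope.

Import ComplexField.Normc.

Definition zeta {R : realType} (s : R) : R := limn (series (riemannR s)).

(* Points of R^d; [measurableTypeR R] is [R] with its Borel sigma-algebra, the
   type over which [uniform_prob] is declared as a measure. *)
Notation point R d := (d.-tuple (measurableTypeR R)).

Section unit_cube.
Context {R : realType}.

Definition cube (d : nat) : set (point R d) :=
  [set x | forall j : 'I_d, (0 : R) <= tnth x j <= 1].

Definition tcons (d : nat) (p : measurableTypeR R * point R d) : point R d.+1 :=
  [tuple of p.1 :: p.2].

Lemma measurable_tcons (d : nat) : measurable_fun [set: _] (@tcons d).
Proof. by apply: measurable_cons; [exact: measurable_fst|exact: measurable_snd]. Qed.

HB.instance Definition _ (d : nat) :=
  isMeasurableFun.Build _ _ _ _ (@tcons d) (@measurable_tcons d).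

(* d-fold product of the uniform distribution on [0, 1], that is, d-dimensional
   Lebesgue measure restricted to [0, 1]^d. *)
Fixpoint cube_prob (d : nat) : probability (point R d) R :=
  match d with
  | 0 => \d_([tuple] : point R 0)
  | d'.+1 => distribution (uniform_prob (@ltr01 R) \x cube_prob d')%E (@tcons d')
  end.

End unit_cube.

Arguments cube {R} d _ : assert.

Section korobov.
Context {R : realType}.
Variables (d : nat) (alpha : R) (gamma : nat -> R).
Implicit Types (f : point R d -> R) (k : d.-tuple int) (x : point R d).

Definition cintegral (D : set (point R d)) (g : point R d -> R[i]) : R[i] :=
  (\int[cube_prob d]_(x in D) complex.Re (g x)) +i* (\int[cube_prob d]_(x in D) complex.Im (g x)).

Definition expi2pi (t : R) : R[i] := cos (2 * pi * t) +i* sin (2 * pi * t).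

Definition dotp k x : R := \sum_(j < d) (tnth k j)%:~R * tnth x j.

Definition fourier f k : R[i] :=
  cintegral (cube d) (fun x => (f x)%:C * expi2pi (- dotp k x)).

(* The quotient |k_j|^alpha / gamma_j is +oo when gamma_j = 0; the coordinates
   are numbered from 0, so that gamma_j is [gamma (j - 1)]. *)
Definition rfun k : \bar R :=
  (\prod_(j < d | tnth k j != 0%R)
     if gamma j == 0%R then +oo
     else (`|(tnth k j)%:~R| `^ alpha / gamma j)%:E)%E.

Definition norm_sqr f : \bar R :=
  (\esum_(k in [set: d.-tuple int])
     ((normc (fourier f k))%:E ^+ 2 * rfun k ^+ 2))%E.

Definition korobov_norm f : \bar R := sqrte (norm_sqr f).

(* A function on [0, 1]^d is represented by a function on R^d of which only the
   values on [0, 1]^d are used. *)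
Definition one_periodic f : Prop :=
  forall (j : 'I_d) x y, cube d x -> cube d y ->
    tnth x j = 0 -> tnth y j = 1 ->
    (forall i, i != j -> tnth x i = tnth y i) -> f x = f y.

Definition fourier_series f : Prop :=
  summable [set: d.-tuple int] (fun k => (normc (fourier f k))%:E) /\
  forall x, cube d x ->
    normc (summability.partial_sum (fun k => fourier f k * expi2pi (dotp k x)) A
           - (f x)%:C) @[A --> summability.totally] --> (0 : R).

Definition korobov f : Prop :=
  [/\ one_periodic f,
      fourier_series f,
      forall k, rfun k = +oo%E -> fourier f k = 0 &
      (norm_sqr f < +oo)%E].

Definition unit_ball : set (point R d -> R) :=
  [set f | korobov f /\ (korobov_norm f <= 1)%E].

End korobov.

Section lattice_rules.
Context {R : realType}.
Variable d : nat.

Definition integ (f : point R d -> R) : R := \int[cube_prob d]_(x in cube d) f x.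

Definition frac (x : R) : R := x - (Num.floor x)%:~R.

(* Generating vectors are taken in {0, ..., N-1}^d; [gen_vectors] below singles
   out those with nonzero components. *)
Definition lattice (N : nat) (z : d.-tuple 'I_N) : seq (point R d) :=
  [seq [tuple frac ((n * tnth z j)%N%:R / N%:R) | j < d] | n <- iota 0 N].

Definition shift (P : seq (point R d)) (Delta : point R d) : seq (point R d) :=
  [seq [tuple frac (tnth x j + tnth Delta j) | j < d] | x <- P].

Definition qrule (P : seq (point R d)) (f : point R d -> R) : R :=
  (size P)%:R^-1 * \sum_(x <- P) f x.

Definition ewor (alpha : R) (gamma : nat -> R) (P : seq (point R d)) : \bar R :=
  ereal_sup [set `|integ f - qrule P f|%:E | f in unit_ball alpha gamma].

End lattice_rules.

Definition primes_in (M : nat) : seq nat :=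
  [seq p <- iota 0 M.+1 | prime p & uphalf M < p <= M]%N.

Definition gen_vectors (d N : nat) : {set d.-tuple 'I_N} :=
  [set z : d.-tuple 'I_N | [forall j : 'I_d, 0 < val (tnth z j)]%N].

Definition draws (d r N : nat) : {set r.-tuple (d.-tuple 'I_N)} :=
  [set zs : r.-tuple (d.-tuple 'I_N) | [forall i : 'I_r, tnth zs i \in gen_vectors d N]].

(* The expectation of [F] under the uniform distribution on a finite set listed
   without repetition by [s]. *)
Definition mean {R : realType} (T : Type) (s : seq T) (F : T -> \bar R) : \bar R :=
  ((size s)%:R^-1%:E * \sum_(x <- s) F x)%E.

Section randomized_rule.
Context {R : realType}.
Variables (d r M : nat) (alpha : R) (gamma : nat -> R).

(* [sel N zs] is the index of the vector retained among [zs]; ties are broken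
   arbitrarily. *)
Definition selects_best (sel : forall N, r.-tuple (d.-tuple 'I_N) -> 'I_r) : Prop :=
  forall (N : nat) zs (i : 'I_r), N \in primes_in M -> zs \in draws d r N ->
    (ewor alpha gamma (lattice (tnth zs (sel N zs)))
     <= ewor alpha gamma (lattice (tnth zs i)))%E.

Variable sel : forall N, r.-tuple (d.-tuple 'I_N) -> 'I_r.

(* Expectation over N, then over the vectors given N, then over the independent
   uniform shift. *)
Definition mean_sqr_error (f : point R d -> R) : \bar R :=
  mean (primes_in M) (fun N =>
    mean (enum (draws d r N)) (fun zs =>
      \int[cube_prob d]_(Delta in cube d)
        (`|integ f - qrule (shift (lattice (tnth zs (sel zs))) Delta) f| ^+ 2)%:E))%E.

Definition erms : \bar R :=
  ereal_sup [set sqrte (mean_sqr_error f) | f in unit_ball alpha gamma].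

End randomized_rule.

Definition korobov_prod {R : realType} (d : nat) (alpha : R) (gamma : nat -> R)
    (lambda : R) : R :=
  \prod_(j < d) (1 + 2 * gamma j `^ lambda^-1 * zeta (alpha / lambda)).

(* Main.v *)
Require Import Defs.
From HB Require Import structures.
From mathcomp Require Import all_boot all_order all_algebra.
From mathcomp Require Import finmap complex.
From mathcomp Require Import all_classical all_reals all_analysis.
From mathcomp Require Import measurable_realfun.
From mathcomp Require Import zify ring lra.
From mathcomp Require summability.

(** Write c_k for the Fourier coefficients of f, w(k) = 1 / r(k), and L(z) for
    the dual lattice of z, that is the set of k with k.z = 0 mod N.

    Averaging over the shift.  By aliasing, the rule shifted by Delta applied to
    f is the sum over L(z) of c_k exp(2 pi i k.Delta) ([qrule_trigpoly]).  The
    term k = 0 is the integral, so by orthogonality the mean squared error over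
    Delta is the sum of |c_k|^2 over the nonzero k in L(z)
    ([integral_sqr_error_le]).  In the unit ball |c_k|^2 = w(k)^2 u_k, where the
    nonnegative u_k have sum at most 1 ([unit_ballP]).  Hence it suffices to
    bound w(k)^2 P(k in L(z0)) uniformly in k <> 0,
    where z0 is the retained vector.

    The retained vector.  Let V be the product in the statement and let
    T = 4 V / ((1 - eta) M).  The average over z of the sum of w(k)^(1/lambda)
    over L(z) without 0 is at most 4 V / M ([sum_dual_weight_le]), because a
    prime N that does not divide k divides k.z for a proportion at most
    1 / (N - 1) of the z ([card_dual]), while the multiples of N contribute at
    most V / N.  By Markov's inequality that sum exceeds T for a proportion at
    most 1 - eta of the z.  All r draws are bad with probability at most
    (1 - eta)^r; in that event w <= 1 bounds the error by 1, which is the second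
    term of the estimate.  Otherwise z0 is at least as good as some good draw,
    and two estimates of the worst-case error apply.  By the Cauchy-Schwarz
    inequality it is at most B = T^lambda for a good vector ([ewor_le]), and it
    is at least w(k) for every nonzero k in the dual lattice, as the function
    w(k) cos(2 pi k.x) shows ([weight_le_ewor]).  So only frequencies with
    w(k) <= B are seen by z0.

    The remaining frequencies.  For these, k is in L(z0) only if it is in the
    dual lattice of one of the r draws, which has probability at most
    r (2 / M + P(N divides k)).  Each prime N of the range is at least sqrt M,
    so at most 2 ln |k_j| / ln M of them divide a nonzero component k_j, and
    there are at least c M / ln M primes in the range by Chebyshev's estimate
    ([size_primes_in_lower]).  The logarithm of |k_j| <= w(k)^(-1/alpha) is
    absorbed by the factor w(k)^delta ([weight_prime_density]), and the
    remaining factor w(k)^(2 - delta) is at most B^(2 - delta). *)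

Set Implicit Arguments.
Unset Strict Implicit.
Unset Printing Implicit Defensive.

Import Order.TTheory GRing.Theory Num.Theory.
Import numFieldNormedType.Exports.

(** * Primes in a dyadic interval *)

Definition primorial (n : nat) := \prod_(p < n.+1 | prime p) p.

Lemma primorialS n : primorial n.+1 = primorial n * (if prime n.+1 then n.+1 else 1).
Proof. by rewrite /primorial big_mkcond big_ord_recr /= -big_mkcond. Qed.

Lemma dvdn_prod_primes (s : seq nat) (m : nat) :
  uniq s -> all prime s -> (forall p, p \in s -> p %| m) -> \prod_(p <- s) p %| m.
Proof.
elim: s m => [|p s IH] m /=; first by rewrite big_nil dvd1n.
move=> /andP[ps us] /andP[pp sp] dv; rewrite big_cons Gauss_dvd.
  by rewrite dv ?mem_head// IH// => q qs; apply: dv; rewrite inE qs orbT.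
rewrite coprime_sym big_seq; elim/big_ind: _ => [|x y cx cy|q qs].
- exact: coprime1n.
- by rewrite coprimeMl cx cy.
- rewrite prime_coprime ?(allP sp q qs)// dvdn_prime2 ?(allP sp q qs)//.
  by apply: contraNneq ps => <-.
Qed.

(** Every prime in (m + 1, 2m + 1] divides the binomial coefficient, since it
    divides its numerator and exceeds all the factors of its denominator. *)
Lemma primorial_split m : primorial m.*2.+1 %| primorial m.+1 * 'C(m.*2.+1, m).
Proof.
rewrite /primorial -!(big_mkord prime (fun p => p)).
rewrite (@big_cat_nat _ _ _ m.+2)//=; last by lia.
rewrite dvdn_pmul2l; last first.
  by rewrite prodn_cond_gt0// => i /prime_gt0.
rewrite -big_filter; apply: dvdn_prod_primes.
- by rewrite filter_uniq// iota_uniq.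
- by apply/allP => p; rewrite mem_filter => /andP[].
move=> p; rewrite mem_filter mem_index_iota => /and3P[pp mp pm].
have le : m <= m.*2.+1 by lia.
have := bin_fact le => /(congr1 (dvdn p)).
have -> : p %| m.*2.+1`! by rewrite dvdn_fact// prime_gt0//=; lia.
have np k : k < p -> (p %| k`!) = false.
  move=> kp; apply/negP; rewrite fact_prod big_seq; apply/negP.
  elim/big_ind: _ => [|x y|i]; first by rewrite dvdn1; case: eqP pp => // ->.
    by rewrite Euclid_dvdM// negb_or => -> ->.
  by rewrite mem_index_iota => /andP[i0 ik]; rewrite gtnNdvd//; lia.
by rewrite !Euclid_dvdM// !np ?orbF//; lia.
Qed.

(** The coefficient occurs twice in the expansion of (1 + 1)^(2m + 1). *)
Lemma bin_odd_le m : 'C(m.*2.+1, m) <= 4 ^ m.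
Proof.
rewrite -(@leq_pmul2l 2)// -[4]/(2 ^ 2) -expnM -expnS.
have -> : (2 * m).+1 = m.*2.+1 by lia.
rewrite -[2 ^ _]/((1 + 1) ^ _) expnDn.
under eq_bigr do rewrite !exp1n !muln1.
have lm : m < m.*2.+2 by lia.
have lm1 : m.+1 < m.*2.+2 by lia.
rewrite (bigD1 (Ordinal lm))//= (bigD1 (Ordinal lm1))/=; last first.
  by rewrite -val_eqE/=; lia.
have -> : 'C(m.*2.+1, m.+1) = 'C(m.*2.+1, m).
  by rewrite -bin_sub; [congr 'C(_, _)|]; lia.
lia.
Qed.

(** The factor contributed by the primes in (m + 1, 2m + 1] is at most 4^m, by
    [primorial_split] and [bin_odd_le]; even numbers contribute none. *)
Lemma primorial_le n : primorial n <= 4 ^ n.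
Proof.
elim/ltn_ind: n => -[|[|[|n]]] IH.
- by rewrite /primorial big_mkcond !big_ord_recl big_ord0.
- by rewrite /primorial big_mkcond !big_ord_recl big_ord0.
- by rewrite /primorial big_mkcond !big_ord_recl big_ord0.
have [m [mE|mE]] : exists m, n = m.*2 \/ n = m.*2.+1.
  exists n./2; have := odd_double_half n; lia.
- have -> : n.+3 = (m.+1).*2.+1 by lia.
  apply: leq_trans (dvdn_leq _ (primorial_split _)) _.
    rewrite muln_gt0 bin_gt0; apply/andP; split; last by lia.
    by apply: prodn_cond_gt0 => i /prime_gt0.
  have -> : 4 ^ m.+1.*2.+1 = 4 ^ m.+2 * 4 ^ m.+1.
    by rewrite -expnD; congr (_ ^ _); lia.
  by rewrite leq_mul// ?bin_odd_le//; apply: IH; lia.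
- rewrite primorialS ifF ?muln1; last first.
    apply/negP => /even_prime; lia.
  apply: leq_trans (IH n.+2 _) _; first lia.
  by rewrite leq_exp2l.
Qed.

(** Induction with (n + 1) C(2n + 2, n + 1) = 2 (2n + 1) C(2n, n). *)
Lemma central_bin_ge n : 0 < n -> 4 ^ n <= n.*2 * 'C(n.*2, n).
Proof.
elim: n => // -[_ _|n IH _]; first by rewrite binS.
have {}IH := IH isT.
have e1 : n.+2 * 'C(n.+2.*2, n.+2) = n.+2.*2 * 'C(n.+1.*2.+1, n.+1).
  by rewrite -mul_bin_diag.
have e2 : n.+2 * 'C(n.+1.*2.+1, n.+1) = n.+1.*2.+1 * 'C(n.+1.*2, n.+1).
  have := mul_bin_down n.+1.*2.+1 n.+1.
  by have -> : n.+1.*2.+1 - n.+1 = n.+2 by lia.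
rewrite expnS; nia.
Qed.

(** Legendre's formula for (2n)! / (n!)^2. *)
Lemma logn_central p n : prime p ->
  logn p 'C(n.*2, n) = \sum_(1 <= k < n.*2.+1) (n.*2 %/ p ^ k - (n %/ p ^ k).*2).
Proof.
move=> pp.
have le : n <= n.*2 by lia.
have fgt := fact_gt0.
have := bin_fact le; have -> : n.*2 - n = n by lia.
move=> /(congr1 (logn p)); rewrite !lognM ?muln_gt0 ?bin_gt0 ?fgt// !logn_fact//.
have ext : \sum_(1 <= k < n.+1) n %/ p ^ k = \sum_(1 <= k < n.*2.+1) n %/ p ^ k.
  rewrite [RHS](@big_cat_nat _ _ _ n.+1)//=.
  rewrite [X in _ = _ + X]big1_seq ?addn0//= => i.
  rewrite mem_index_iota => /andP[ni _]; rewrite divn_small//.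
  by apply: leq_trans (ltn_expl _ (prime_gt1 pp)); lia.
rewrite ext => h.
set S := \sum_(1 <= k < _) _ in h; apply/eqP; rewrite -(eqn_add2r (S + S)) h.
rewrite /S -!big_split/=; apply/eqP; apply: eq_bigr => k _.
rewrite addnn subnK// -[X in X <= _]mul2n leq_divRL ?expn_gt0 ?prime_gt0//.
by rewrite -mulnA -[X in _ <= X]mul2n leq_mul2l leq_trunc_div.
Qed.

(** Each term of Legendre's formula is 0 or 1, and those with p^k > 2n vanish. *)
Lemma logn_central_le p n : prime p -> 0 < n -> p ^ logn p 'C(n.*2, n) <= n.*2.
Proof.
move=> pp n0; rewrite logn_central//.
have p1 := prime_gt1 pp.
have n20 : 0 < n.*2 by lia.
apply: leq_trans (trunc_logP p1 n20); rewrite leq_exp2l//.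
set t := trunc_log p n.*2.
have tn : t <= n.*2.
  by apply: ltnW; apply: leq_trans (ltn_expl _ p1) (trunc_logP p1 n20).
rewrite (@big_cat_nat _ _ _ t.+1)//= [X in _ + X]big1_seq ?addn0.
  apply: (@leq_trans (\sum_(1 <= k < t.+1) 1)); last first.
    by rewrite sum_nat_const_nat muln1 subn1.
  apply: leq_sum => k _.
  have p0 : 0 < p ^ k by rewrite expn_gt0 ltnW.
  by rewrite -addnn divnD// -addnn addKn leq_b1.
move=> i; rewrite mem_index_iota => /andP[_ /andP[ti _]].
rewrite divn_small//; apply: leq_trans (trunc_log_ltn _ p1) _.
by rewrite leq_exp2l.
Qed.

Lemma logn_central_le1 p n : prime p -> n.*2 < p * p -> logn p 'C(n.*2, n) <= 1.
Proof.
case: n => [|n]; first by rewrite bin0 logn1.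
move=> pp h; have := @logn_central_le p n.+1 pp isT.
case: (logn _ _) => [|[|e]]// le.
have : p * p <= p ^ e.+2 by rewrite mulnn (leq_exp2l _ _ (prime_gt1 pp)).
by move: le h; clear; lia.
Qed.

(** For 2n/3 < p <= n the two multiples p and 2p of p up to 2n cancel against
    the squared factor p of the denominator. *)
Lemma logn_central_eq0 p n : prime p -> n.*2 < p * p -> p <= n -> n.*2 < 3 * p ->
  logn p 'C(n.*2, n) = 0.
Proof.
move=> pp h pn h3; rewrite logn_central// big1_seq// => k.
rewrite mem_index_iota => /andP[_ /andP[k1 _]].
case: k k1 => // -[|k] _.
  rewrite expn1.
  have p0 := prime_gt0 pp.
  have -> : n %/ p = 1 by apply/eqP; rewrite eqn_leq leq_divRL// -ltnS ltn_divLR//; lia.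
  have -> // : n.*2 %/ p = 2.
  by apply/eqP; rewrite eqn_leq leq_divRL// -ltnS ltn_divLR//; lia.
rewrite divn_small//; apply: leq_trans h _.
by rewrite mulnn (leq_exp2l _ _ (prime_gt1 pp)).
Qed.

Definition nprimes_between (m n : nat) := count prime (index_iota m.+1 n.+1).

(** Erdős's factorization bound: primes up to the square root s of 2n contribute
    at most 2n each, those up to 2n/3 contribute at most their product, those in
    (2n/3, n] contribute nothing, and those in (n, 2n] at most 2n each. *)
Lemma central_bin_le n s : 2 < n -> n.*2 < s.+1 * s.+1 ->
  'C(n.*2, n) <= n.*2 ^ s.+1 * 4 ^ (n.*2 %/ 3) * n.*2 ^ nprimes_between n n.*2.
Proof.
move=> n2 hs.
have n20 : 0 < n.*2 by lia.
have C0 : 0 < 'C(n.*2, n) by rewrite bin_gt0; lia.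
pose m := maxn 'C(n.*2, n) (maxn n.*2 s.+1).
have mC : 'C(n.*2, n) <= m by lia.
rewrite -{1}(partnT C0) (widen_partn _ mC) /=.
(* [a], [b] and [c] bound the contributions of p <= s, of p <= 2n/3 and of
   n < p <= 2n; a prime of (2n/3, n] above s contributes 1. *)
pose a p := if p < s.+1 then n.*2 else 1.
pose b p := if (p < (n.*2 %/ 3).+1) && prime p then p else 1.
pose c p := if (n.+1 <= p < n.*2.+1) && prime p then n.*2 else 1.
apply: (@leq_trans (\prod_(0 <= p < m.+1) (a p * b p * c p))).
  apply: leq_prod => p _.
  have a0 : 0 < a p by rewrite /a; case: ifP.
  have b0 : 0 < b p by rewrite /b; case: ifP => // /andP[_ /prime_gt0].
  have c0 : 0 < c p by rewrite /c; case: ifP.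
  have [pp|np] := boolP (prime p); last first.
    by rewrite lognE (negbTE np)/= expn0 !muln_gt0 a0 b0 c0.
  have [ps|ps] := ltnP p s.+1.
    apply: leq_trans (logn_central_le pp _) _; first lia.
    by rewrite {1}/a ps -mulnA leq_pmulr// muln_gt0 b0 c0.
  have hp : n.*2 < p * p by apply: leq_trans hs _; rewrite leq_mul.
  have p0 := prime_gt0 pp.
  have [p3|p3] := leqP (3 * p) n.*2.
    apply: (@leq_trans p).
      by rewrite -[X in _ <= X]expn1 leq_pexp2l// logn_central_le1.
    have -> : b p = p by rewrite /b pp andbT ltnS leq_divRL// mulnC p3.
    by rewrite mulnAC leq_pmull// muln_gt0 a0 c0.
  have [pn|pn] := leqP p n.
    by rewrite logn_central_eq0// expn0 !muln_gt0 a0 b0 c0.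
  have n0 : 0 < n by lia.
  have := logn_central_le pp n0.
  have [pn2|pn2] := leqP p n.*2.
    move=> h; apply: leq_trans h _.
    have -> : c p = n.*2 by rewrite /c pn ltnS pn2 pp.
    by rewrite leq_pmull// muln_gt0 a0 b0.
  case: (logn _ _) => [_|e]; first by rewrite expn0 !muln_gt0 a0 b0 c0.
  have : p <= p ^ e.+1 by rewrite expnS leq_pmulr// expn_gt0 p0.
  lia.
rewrite !big_split /=; apply: leq_mul; first apply: leq_mul.
- rewrite /a (@big_cat_nat _ _ _ s.+1)//=; last by lia.
  rewrite [X in _ * X]big1_seq ?muln1; last first.
    by move=> i /=; rewrite mem_index_iota leqNgt => /andP[/negbTE->].
  under eq_big_nat => i /andP[_ ->] do idtac.
  by rewrite prod_nat_const_nat subn0.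
- apply: leq_trans (primorial_le _).
  rewrite /primorial -!(big_mkord prime (fun p => p)) big_mkcond/=.
  rewrite (@big_cat_nat _ _ _ (n.*2 %/ 3).+1)//=; last first.
    by rewrite ltnS; apply: leq_trans (leq_div _ _) _; lia.
  rewrite [X in _ * X]big1_seq ?muln1; last first.
    by move=> i /=; rewrite mem_index_iota leqNgt /b => /andP[/negbTE->].
  rewrite [X in _ <= X]big_mkcond.
  by under eq_big_nat => i /andP[_ li] do rewrite /b li.
- rewrite /c -big_mkcond/= /nprimes_between.
  rewrite big_const_seq iter_muln_1.
  rewrite leq_pexp2l// -!size_filter uniq_leq_size ?filter_uniq ?iota_uniq// => p.
  by rewrite !mem_filter !mem_index_iota => /andP[/andP[/andP[-> ->] ->]] _.
Qed.

(** Comparing the two bounds on C(2n, n) forces about n / log n primes into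
    (n, 2n], as 4^(2n/3) accounts for only two thirds of the exponent. *)
Lemma primes_between_lower n s : 2 < n -> n.*2 < s.+1 * s.+1 ->
  4 ^ n <= n.*2 ^ (s.+2 + nprimes_between n n.*2) * 4 ^ (n.*2 %/ 3).
Proof.
move=> n2 hs; have n0 : 0 < n by lia.
apply: leq_trans (central_bin_ge n0) _.
rewrite expnD expnS -!mulnA leq_mul2l; apply/orP; right.
by rewrite (mulnC (n.*2 ^ nprimes_between _ _)) mulnA; apply: central_bin_le.
Qed.

Import ComplexField.Normc.

Local Open Scope classical_set_scope.
Local Open Scope ring_scope.
Local Open Scope complex_scope.

Local Notation Rpoint R d := (d.-tuple (measurableTypeR R)).

Lemma nat_sqrt m : exists s, (s * s <= m < s.+1 * s.+1)%N.
Proof.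
elim: m => [|m [s /andP[sm ms]]]; first by exists 0%N.
have [h|h] := ltnP m.+1 (s.+1 * s.+1); first by exists s; rewrite h leqW.
by exists s.+1; rewrite h; lia.
Qed.

(** For odd M the range of [primes_in] starts one step later, at the cost of at
    most the number M/2 + 1. *)
Lemma nprimes_primes_in M :
  (nprimes_between M./2 M./2.*2 <= (size (primes_in M)).+1)%N.
Proof.
rewrite /nprimes_between -size_filter -/(size (M./2.+1 :: primes_in M)).
apply: uniq_leq_size; first by rewrite filter_uniq// iota_uniq.
move=> p; rewrite mem_filter mem_index_iota inE mem_filter mem_iota => /and3P[-> a b] /=.
have := odd_double_half M; have := uphalf_half M; case: eqP => //= h; lia.
Qed.

Section chebyshev.
Variable R : realType.

Lemma ln4_ge1 : 1 <= ln 4 :> R.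
Proof.
have := @le_ln1Dx R (- 2^-1); rewrite (_ : 1 + - 2^-1 = 2^-1); last by lra.
rewrite lnV ?posrE// => h.
have -> : (4 : R) = 2 * 2 by lra.
rewrite lnM ?posrE//; have {}h := h ltac:(lra); lra.
Qed.

Lemma ln_le_sqrt_sqrt (x : R) : 0 < x -> ln x <= 4 * Num.sqrt (Num.sqrt x).
Proof.
move=> x0; set y := Num.sqrt _.
have y0 : 0 < y by rewrite !sqrtr_gt0.
have -> : x = y ^+ 4.
  by rewrite (exprM y 2 2) !sqr_sqrtr ?sqrtr_ge0// ltW.
rewrite lnXn//.
have := @le_ln1Dx R (y - 1); rewrite (_ : 1 + (y - 1) = y) => [h|]; last by lra.
have {}h := h ltac:(lra).
rewrite -[leLHS]mulr_natl; lra.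
Qed.

(** Chebyshev's lower bound.  Above M = 50^4 it follows from
    [primes_between_lower] by taking logarithms; below, the constant is so small
    that a single prime is enough. *)
Lemma size_primes_in_lower : exists2 c : R, 0 < c &
  forall M, (2 <= M)%N -> primes_in M != [::] ->
    c * M%:R <= (size (primes_in M))%:R * ln M%:R.
Proof.
have ln20 : 0 < ln 2 :> R by rewrite ln_gt0// ltr1n.
have ln21 : ln 2 <= 1 :> R.
  by have := @le_ln1Dx R 1 ltac:(lra).
pose c : R := ln 2 / 50 ^+ 4.
have c0 : 0 < c by rewrite divr_gt0// exprn_gt0.
exists c => // M M2 P0.
have MR : (2 : R) <= M%:R by rewrite ler_nat.
have l2M : ln 2 <= ln (M%:R : R) by rewrite ler_ln ?posrE//; lra.
set P := (size _)%:R.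
have P1 : 1 <= P by rewrite ler1n lt0n size_eq0.
have [small|big] := lerP (M%:R : R) (50 ^+ 4).
  apply: (@le_trans _ _ (ln 2)); last first.
    by apply: (le_trans l2M); rewrite ler_peMl//; lra.
  by rewrite /c mulrAC ler_pdivrMr ?exprn_gt0// ler_wpM2l// ltW.
have M50 : (50 < M)%N by rewrite -(ltr_nat R); nra.
have n2 : (2 < M./2)%N by have := odd_double_half M; lia.
have nM' : (M./2.*2 <= M <= M./2.*2.+1)%N.
  by have := leq_b1 (odd M); have := odd_double_half M; lia.
have [s /andP[sM Ms]] := nat_sqrt M./2.*2.
have := primes_between_lower n2 Ms.
have := nprimes_primes_in M.
set n := M./2 in n2 sM Ms nM' *; set nb := nprimes_between _ _ => nbP.
have n20 : 0 < n.*2%:R :> R by rewrite ltr0n; lia.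
rewrite -(ler_nat R) natrM !natrX => h0.
have : ln (4 ^+ n) <= ln (n.*2%:R ^+ (s.+2 + nb) * 4 ^+ (n.*2 %/ 3)) :> R.
  have pw (a : R) m : 0 < a -> 0 < a ^+ m by move=> ?; rewrite exprn_gt0.
  by rewrite ler_ln// posrE; [exact: pw|rewrite mulr_gt0//; exact: pw].
rewrite lnM ?posrE ?exprn_gt0// !lnXn// -![ln _ *+ _]mulr_natl.
set L := ln n.*2%:R; set K : R := ln 4 => main.
have K1 : 1 <= K := ln4_ge1.
have nM : n.*2%:R <= M%:R :> R by rewrite ler_nat; case/andP: nM'.
have Mn : M%:R <= n.*2%:R + 1 :> R.
  by rewrite natr1 ler_nat; case/andP: nM'.
have MR0 : 0 < M%:R :> R by apply: lt_le_trans nM.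
have LM : L <= ln M%:R by rewrite ler_ln.
have L0 : 0 <= L by rewrite ln_ge0// ler1n -(ltr0n R).
(* In terms of y = M^(1/4), s <= y^2 and ln M <= 4 y, so the error terms are
   of order y^3 against the main term y^4 / 6. *)
pose y : R := Num.sqrt (Num.sqrt M%:R).
have y4 : y ^+ 4 = M%:R by rewrite (exprM y 2 2) !sqr_sqrtr ?sqrtr_ge0.
have y0 : 0 <= y by rewrite sqrtr_ge0.
have y50 : 50 < y by rewrite -(@ltr_pXn2r _ 4)// ?nnegrE// y4.
have Ly : ln M%:R <= 4 * y by apply: ln_le_sqrt_sqrt; lra.
have sy : s%:R <= y ^+ 2.
  rewrite -(@ler_pXn2r _ 2)// ?nnegrE ?exprn_ge0//.
  by rewrite -exprM y4 -natrX; apply: le_trans nM; rewrite ler_nat -mulnn.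
have n3 : (n.*2 %/ 3)%:R * 3 <= n.*2%:R :> R.
  by rewrite -natrM ler_nat leq_trunc_div.
have nbR : nb%:R <= P + 1 by rewrite natr1 ler_nat.
have nE : n.*2%:R = 2 * n%:R :> R by rewrite -mul2n natrM.
have sE : (s.+2 + nb)%N%:R <= y ^+ 2 + 3 + P.
  by rewrite natrD -addn2 natrD; lra.
have n0 : 0 <= n%:R :> R by [].
have main2 : n%:R * K <= (y ^+ 2 + 3 + P) * ln M%:R + (n.*2 %/ 3)%:R * K.
  apply: le_trans main _; rewrite lerD2r; apply: ler_pM => //.
have main3 : n%:R / 3 <= (y ^+ 2 + 3 + P) * ln M%:R.
  apply: (@le_trans _ _ (n%:R / 3 * K)); first by rewrite ler_peMr//; lra.
  have : (n.*2 %/ 3)%:R * K <= 2 * n%:R / 3 * K by rewrite ler_wpM2r//; lra.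
  by lra.
have main4 : n%:R / 3 <= (y ^+ 2 + 3) * (4 * y) + P * ln M%:R.
  apply: le_trans main3 _; rewrite mulrDl lerD2r ler_wpM2l//.
  by rewrite addr_ge0// exprn_ge0.
have cy : c * M%:R <= M%:R / 12.
  rewrite mulrC ler_wpM2l// /c ler_pdivrMr ?exprn_gt0//.
  by apply: le_trans ln21 _; rewrite -natrX; lra.
apply: le_trans cy _.
have : y ^+ 4 / 12 + (y ^+ 2 + 3) * (4 * y) <= n%:R / 3.
  have y3 : 50 ^+ 3 <= y ^+ 3 by rewrite ler_pXn2r ?nnegrE// ltW.
  have : 50 * y ^+ 3 <= y ^+ 4 by rewrite (exprS y 3) ler_wpM2r ?exprn_ge0// ltW.
  have : 50 ^+ 2 * y <= y ^+ 3.
    by rewrite (exprSr y 2) ler_wpM2r// ler_pXn2r ?nnegrE// ltW.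
  have -> : (y ^+ 2 + 3) * (4 * y) = 4 * y ^+ 3 + 12 * y by ring.
  move: y3 y4 Mn nE; rewrite -!natrX; lra.
rewrite y4; lra.
Qed.

End chebyshev.

(** * Integration over the unit cube *)

Lemma periodicz (R : realType) (f : R -> R) (T : R) : periodic f T ->
  forall (m : int) a, f (a + T * m%:~R) = f a.
Proof.
move=> pf [n|n] a; first by rewrite -pmulrn mulr_natr (periodicn pf).
rewrite NegzE mulrNz mulrN -pmulrn mulr_natr.
by rewrite -[in RHS](subrK (T *+ n.+1) a) (periodicn pf).
Qed.

Section cube_integration.
Variable R : realType.

Lemma cosD2piz (m : int) (x : R) : cos (x + 2 * pi * m%:~R) = cos x.
Proof. by rewrite [2 * pi]mulr_natl (periodicz (@cosD2pi R)). Qed.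

Lemma sinD2piz (m : int) (x : R) : sin (x + 2 * pi * m%:~R) = sin x.
Proof. by rewrite [2 * pi]mulr_natl (periodicz (@sinD2pi R)). Qed.

Local Notation mu := (@lebesgue_measure R).

Lemma measurable_cube d : measurable (@cube R d).
Proof.
have -> : @cube R d = \big[setI/setT]_(j < d)
    ((@tnth d (measurableTypeR R) ^~ j) @^-1` `[0, 1]%classic).
  rewrite -bigcap_seq; apply/seteqP; split => x /=.
    by move=> cx j _; rewrite /= in_itv/=; exact: cx.
  by move=> cx j; have := cx j (mem_index_enum _); rewrite /= in_itv/=.
apply: bigsetI_measurable => j _.
rewrite -[X in measurable X]setTI; exact: measurable_tnth.
Qed.

Lemma cube_tcons d (t : R) (x : Rpoint R d) :
  cube d.+1 (tcons (t, x)) <-> (0 <= t <= 1) /\ cube d x.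
Proof.
split=> [cx|[t01 cx] j].
  split; first by have := cx ord0; rewrite tnth0.
  by move=> j; have := cx (lift ord0 j); rewrite tnthS.
by case: (unliftP ord0 j) => [i|] ->; rewrite ?tnthS ?tnth0.
Qed.

(** Tonelli's theorem for one coordinate of the cube.  Nonnegativity spares all
    integrability conditions; this is why the trigonometric integrals below are
    stated for 1 + cos. *)
Lemma ge0_integral_cubeS d (F : Rpoint R d.+1 -> \bar R) :
  measurable_fun [set: Rpoint R d.+1] F -> (forall x, 0 <= F x)%E ->
  (\int[cube_prob d.+1]_(x in cube d.+1) F x =
   \int[mu]_(t in `[0%R, 1%R]) \int[cube_prob d]_(x in cube d) F (tcons (t, x)))%E.
Proof.
move=> mF F0; rewrite integral_mkcond /=.
have mFc : measurable_fun setT (F \_ (cube d.+1)).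
  by apply: (measurable_restrictT F (@measurable_cube d.+1)).1; exact: measurable_funTS.
have Fc0 x : (0 <= (F \_ (cube d.+1)) x)%E by rewrite patchE; case: ifP.
rewrite ge0_integral_distribution//.
have mt : measurable_fun setT ((F \_ (cube d.+1)) \o @tcons R d).
  by apply: measurableT_comp => //; exact: measurable_tcons.
rewrite fubini_tonelli1//; last by move=> x; exact: Fc0.
rewrite integral_uniform; last 2 first.
- by apply: measurable_fun_fubini_tonelli_F => // x; exact: Fc0.
- by move=> t; apply: integral_ge0 => x _; exact: Fc0.
rewrite subr0 invr1 mul1e; apply: eq_integral => t.
rewrite inE/= in_itv/= => t01; rewrite /fubini_F [RHS]integral_mkcond.
apply: eq_integral => x _ /=; rewrite !patchE.
have -> // : (tcons (t, x) \in cube d.+1) = (x \in cube d).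
by apply/idP/idP; rewrite !inE => cx; [case/cube_tcons: cx|apply/cube_tcons].
Qed.

Lemma measurable_dotp d (k : d.-tuple int) : measurable_fun setT (@dotp R d k).
Proof.
apply: measurable_sum => j; apply: measurable_funM => //.
exact: measurable_tnth.
Qed.

Lemma measurable_cos_dotp d (k : d.-tuple int) (th : R) :
  measurable_fun setT (fun x : Rpoint R d => cos (th + 2 * pi * dotp k x)).
Proof.
apply: (measurableT_comp (continuous_measurable_fun (@continuous_cos R))).
apply: measurable_funD => //; apply: measurable_funM => //.
exact: measurable_dotp.
Qed.

Lemma dotp_tcons d (k : d.+1.-tuple int) t (x : Rpoint R d) :
  dotp k (tcons (t, x)) = (thead k)%:~R * t + dotp (behead_tuple k) x.
Proof.
rewrite /dotp big_ord_recl; congr (_ * _ + _).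
apply: eq_bigr => j _; rewrite /tcons tnthS; congr (_%:~R * _).
by rewrite [in LHS](tuple_eta k) tnthS.
Qed.

Lemma integral_cos1 (m : int) (th : R) :
  (\int[mu]_(t in `[0%R, 1%R]) (1 + cos (th + 2 * pi * (m%:~R * t)))%:E =
   (1 + (m == 0)%:R * cos th)%:E)%E.
Proof.
have [->|m0] := eqVneq m 0.
  under eq_integral do rewrite mul0r mulr0 addr0.
  rewrite integral_cst//= lebesgue_measure_itv/= lte_fin ltr01 oppr0 adde0 mule1.
  by rewrite mul1r.
pose w : R := 2 * pi * m%:~R.
have w0 : w != 0 by rewrite mulf_neq0 ?intr_eq0// mulf_neq0// gt_eqF ?pi_gt0.
pose G (t : R) := t + w^-1 * sin (th + w * t).
have cf (t : R) : {for t, continuous (fun u : R => th + w * u)}.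
  by apply: continuousD; [exact: cvg_cst|apply: continuousM; [exact: cvg_cst|exact: cvg_id]].
have cc : continuous (fun t : R => 1 + cos (th + w * t)).
  move=> t; apply: continuousD; first exact: cvg_cst.
  apply: (@continuous_comp _ _ _ (fun u => th + w * u) cos); first exact: cf.
  exact: continuous_cos.
have dG (t : R) : is_derive t 1 G (1 + cos (th + w * t)).
  have dl : is_derive t 1 (fun u : R => th + w * u) w.
    by apply: is_derive_eq; rewrite /GRing.scale/= mulr1 add0r mul1r.
  have ds := @is_derive1_comp R sin (fun u => th + w * u) t _ _ (is_derive_sin (th + w * t)) dl.
  apply: is_derive_eq.
  by rewrite /GRing.scale/=; field.
have cG : continuous G.
  by move=> t; apply: differentiable_continuous; apply/derivable1_diffP; case: (dG t).
under eq_integral do rewrite mulrA.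
rewrite (@continuous_FTC2 _ _ G)//.
- by rewrite /G -EFinD mulr1 mulr0 addr0 sinD2piz add0r mul0r addrK addr0.
- exact: continuous_subspaceT.
- split; first by move=> t _; case: (dG t).
  + by apply: cvg_at_right_filter; exact: cG.
  + by apply: cvg_at_left_filter; exact: cG.
- by move=> t _; rewrite derive1E; apply: derive_val.
Qed.

(** The phase [th] is what makes the induction on the dimension go through: the
    inner integral is again of this form, with the phase shifted by the
    first coordinate. *)
Lemma integral_cos d (k : d.-tuple int) (th : R) :
  (\int[cube_prob d]_(x in cube d) (1 + cos (th + 2 * pi * dotp k x))%:E =
   (1 + [forall j, tnth k j == 0]%:R * cos th)%:E)%E.
Proof.
elim: d k th => [|d IH] k th.
  rewrite integral_dirac/=; first last.
  - apply/measurable_EFinP/measurable_funTS; apply: measurable_funD => //.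
    exact: measurable_cos_dotp.
  - exact: measurable_cube.
  have -> : [forall j, tnth k j == 0] by apply/forallP => -[].
  rewrite diracE mem_set ?mul1e; last by case.
  by rewrite /dotp big_ord0 mulr0 addr0 mul1r.
rewrite ge0_integral_cubeS; last 2 first.
- apply/measurable_EFinP; apply: measurable_funD => //.
  exact: measurable_cos_dotp.
- by move=> x; rewrite lee_fin -lerBlDl sub0r cos_geN1.
under eq_integral.
  move=> t _.
  under eq_integral do rewrite dotp_tcons mulrDr addrA.
  rewrite IH; over.
have -> : [forall j, tnth k j == 0] = (thead k == 0) && [forall j, tnth (behead_tuple k) j == 0].
  apply/forallP/andP.
    move=> h; split; first exact: h.
    by apply/forallP => j; have := h (lift ord0 j); rewrite [in X in X -> _](tuple_eta k) tnthS.
  move=> [h0 /forallP h] j; case: (unliftP ord0 j) => [i|] ->//.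
  by rewrite [in X in tnth X](tuple_eta k) tnthS.
case: [forall _, _]; last first.
  rewrite andbF !mul0r addr0.
  under eq_integral do rewrite mul0r addr0.
  by rewrite integral_cst//= lebesgue_measure_itv/= lte_fin ltr01 oppr0 adde0 mule1.
under eq_integral do rewrite mul1r.
by rewrite integral_cos1 andbT.
Qed.

End cube_integration.

(** * Complex exponentials *)

Section complex_exponential.
Variable R : realType.
Implicit Types (s t : R) (z w : R[i]).

Lemma expi2piD s t : expi2pi (s + t) = expi2pi s * expi2pi t :> R[i].
Proof.
rewrite /expi2pi mulrDr cosD sinD; apply/eqP; rewrite eq_complex/= eqxx /=.
by apply/eqP; ring.
Qed.

Lemma expi2pi0 : expi2pi 0 = 1 :> R[i].
Proof. by rewrite /expi2pi mulr0 cos0 sin0. Qed.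

Lemma expi2piDz s (m : int) : expi2pi (s + m%:~R) = expi2pi s.
Proof. by rewrite /expi2pi mulrDr cosD2piz sinD2piz. Qed.

Lemma expi2piMn s n : expi2pi (n%:R * s) = expi2pi s ^+ n.
Proof.
elim: n => [|n IH]; first by rewrite mul0r expi2pi0 expr0.
by rewrite -addn1 natrD mulrDl mul1r expi2piD IH addn1 exprSr.
Qed.

Lemma normc_sqr z : normc z ^+ 2 = complex.Re z ^+ 2 + complex.Im z ^+ 2.
Proof. by case: z => a b; rewrite /normc/= sqr_sqrtr// addr_ge0// sqr_ge0. Qed.

Lemma normc_ge0 z : 0 <= normc z.
Proof. by case: z => a b; exact: sqrtr_ge0. Qed.

Lemma normc_expi2pi t : normc (expi2pi t) = 1.
Proof. by rewrite /expi2pi /normc/= cos2Dsin2 sqrtr1. Qed.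

Lemma normc_real s : normc (s%:C) = `|s|.
Proof. by rewrite /normc/= expr0n/= addr0 sqrtr_sqr. Qed.

Lemma le_normc_Re z : `|complex.Re z| <= normc z.
Proof.
rewrite -(@ler_pXn2r _ 2)// ?nnegrE ?normc_ge0// normc_sqr real_normK ?num_real//.
by rewrite lerDl sqr_ge0.
Qed.

Lemma le_normc_sum (I : Type) (r : seq I) (P : pred I) (F : I -> R[i]) :
  normc (\sum_(i <- r | P i) F i) <= \sum_(i <- r | P i) normc (F i).
Proof.
elim/big_ind2: _ => [|x x' y y' hx hy|//]; first by rewrite normc0.
exact: le_trans (le_normcD _ _) (lerD hx hy).
Qed.

(** Reducing m modulo N brings half the angle into the open interval (0, pi),
    where the sine does not vanish. *)
Lemma expi2pi_neq1 (N : nat) (m : int) : (0 < N)%N -> ~~ (N %| m)%Z ->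
  expi2pi (m%:~R / N%:R) != 1 :> R[i].
Proof.
move=> N0 Nm.
have N0R : (N%:R : R) != 0 by rewrite pnatr_eq0 -lt0n.
have Nz : (N : int) != 0 by rewrite -lt0n in N0 *; case: N N0 {Nm N0R}.
rewrite (divz_eq m N) intrD intrM mulrDl mulfK// addrC expi2piDz.
have := modz_ge0 m Nz; have := ltz_pmod m (d := N) ltac:(by rewrite ltz_nat).
have : (m %% N)%Z != 0 by apply: contra Nm => /eqP/dvdz_mod0P.
move: (m %% N)%Z => [r|//]; rewrite ltz_nat => r0 rN _.
apply/negP; rewrite eq_complex/= => /andP[/eqP c1 _].
pose x : R := pi * (r%:R / N%:R).
have xpi : 0 < x < pi.
  have N0' : (0 : R) < N%:R by rewrite ltr0n.
  rewrite mulr_gt0 ?pi_gt0 ?divr_gt0 ?ltr0n ?lt0n//=.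
  by rewrite gtr_pMr ?pi_gt0// ltr_pdivrMr// mul1r ltr_nat.
have := sin_gt0_pi xpi.
have : cos (x *+ 2) = 1 by rewrite -c1; congr cos; rewrite /x -mulr_natl; ring.
rewrite cos_mulr2n cos2sin2 => h s0.
have : 0 < sin x ^+ 2 by rewrite exprn_gt0.
by move: h; rewrite -mulr_natl; lra.
Qed.

Lemma sum_expi2pi (N : nat) (m : int) : (0 < N)%N ->
  \sum_(0 <= n < N) expi2pi (m%:~R / N%:R) ^+ n = ((N %| m)%Z * N)%N%:R :> R[i].
Proof.
move=> N0; have [/dvdzP[q ->]|Nm] := boolP (N %| m)%Z.
  have N0R : (N%:R : R) != 0 by rewrite pnatr_eq0 -lt0n.
  rewrite intrM mulfK// -[q%:~R]add0r expi2piDz expi2pi0.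
  by under eq_bigr do rewrite expr1n; rewrite sumr_const_nat subn0 mul1n.
rewrite mul0n; set w := expi2pi _.
have w1 : w - 1 != 0 by rewrite subr_eq0; exact: expi2pi_neq1.
apply: (mulfI w1); rewrite mulr0 big_mkord -subrX1.
have N0R : (N%:R : R) != 0 by rewrite pnatr_eq0 -lt0n.
by rewrite -expi2piMn mulrCA mulfV// mulr1 -[m%:~R]add0r expi2piDz expi2pi0 subrr.
Qed.

End complex_exponential.

(** * Trigonometric polynomials *)

Section trigonometric_polynomials.
Variables (R : realType) (d : nat).
Implicit Types (k l m : d.-tuple int) (x y : Rpoint R d).
Local Notation P := (@cube_prob R d).

Definition freq0 : d.-tuple int := [tuple 0 | j < d].
Definition freqB k l : d.-tuple int := [tuple tnth k j - tnth l j | j < d].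

Lemma eq_freq0 k : (k == freq0) = [forall j, tnth k j == 0].
Proof.
apply/eqP/forallP => [-> j|h]; first by rewrite tnth_mktuple.
by apply: eq_from_tnth => j; rewrite tnth_mktuple; apply/eqP.
Qed.

Lemma freqB_eq0 k l : (freqB k l == freq0) = (k == l).
Proof.
rewrite eq_freq0; apply/forallP/eqP => [h|-> j]; last by rewrite tnth_mktuple subrr.
by apply: eq_from_tnth => j; apply/eqP; have := h j; rewrite tnth_mktuple subr_eq0.
Qed.

Lemma dotp_freq0 x : dotp freq0 x = 0.
Proof. by rewrite /dotp big1// => j _; rewrite tnth_mktuple mul0r. Qed.

Lemma dotp_freqB k l x : dotp (freqB k l) x = dotp k x - dotp l x.
Proof.
rewrite /dotp -sumrB; apply: eq_bigr => j _.
by rewrite tnth_mktuple intrB mulrBl.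
Qed.

Lemma integral_cos_freq0 m (th : R) :
  (\int[P]_(x in cube d) (1 + cos (th + 2 * pi * dotp m x))%:E =
   (1 + (m == freq0)%:R * cos th)%:E)%E.
Proof. by rewrite integral_cos eq_freq0. Qed.

Lemma cube_prob_cube : P (cube d) = 1%E.
Proof.
have := integral_cos_freq0 freq0 (pi / 2).
under eq_integral do rewrite dotp_freq0 mulr0 addr0 cos_pihalf addr0.
by rewrite cos_pihalf mulr0 addr0 integral_cst ?mul1e//; exact: measurable_cube.
Qed.

Lemma bounded_integrable_cube (f : Rpoint R d -> R) (B : R) :
  measurable_fun (cube d) f -> (forall x, `|f x| <= B) ->
  P.-integrable (cube d) (EFin \o f).
Proof.
move=> mf fB; apply: measurable_bounded_integrable => //.
- exact: measurable_cube.
- by rewrite [X in (X < _)%E](cube_prob_cube) ltry.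
- exists B; split; first exact: num_real.
  by move=> C BC x _; apply: le_trans (fB x) (ltW BC).
Qed.

Lemma integrable_cst_cube (r : R) : P.-integrable (cube d) (EFin \o cst r).
Proof. by apply: (@bounded_integrable_cube _ `|r|) => //; exact: measurable_cst. Qed.

Lemma integrable_cos m th :
  P.-integrable (cube d) (EFin \o (fun x => cos (th + 2 * pi * dotp m x))).
Proof.
apply: (@bounded_integrable_cube _ 1); last by move=> x; exact: cos_max.
by apply: measurable_funTS; exact: measurable_cos_dotp.
Qed.

(** The orthogonality relation behind all the Fourier computations. *)
Lemma Rintegral_cos m th :
  \int[P]_(x in cube d) cos (th + 2 * pi * dotp m x) = (m == freq0)%:R * cos th.
Proof.
apply: (addrI 1); have := congr1 fine (integral_cos_freq0 m th) => /= <-.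
have {1}-> : 1 = \int[P]_(x in cube d) (1 : R).
  by rewrite (Rintegral_cst _ (@measurable_cube R d)) [X in fine X]cube_prob_cube mulr1.
rewrite -RintegralD//; first exact: measurable_cube.
- exact: integrable_cst_cube.
- exact: integrable_cos.
Qed.

(** Writing the sine as a cosine of phase pi/2 reduces every integral to
    [Rintegral_cos]. *)
Lemma Re_expi2pi (w : R[i]) t : complex.Re (w * expi2pi t) =
  complex.Re w * cos (0 + 2 * pi * t) + complex.Im w * cos (pi / 2 + 2 * pi * t).
Proof.
rewrite add0r [pi / 2 + _]addrC cosDpihalf; case: w => a b /=.
by rewrite mulrN.
Qed.

Lemma integrable_Re_expi2pi (w : R[i]) m :
  P.-integrable (cube d) (EFin \o (fun x => complex.Re (w * expi2pi (dotp m x)))).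
Proof.
under [_ \o _]eq_fun do rewrite /comp Re_expi2pi EFinD !EFinM.
by apply: integrableD => //; [exact: measurable_cube|..];
  apply: integrableZl => //; [exact: measurable_cube|exact: integrable_cos
                             |exact: measurable_cube|exact: integrable_cos].
Qed.

Lemma Rintegral_Re_expi2pi (w : R[i]) m :
  \int[P]_(x in cube d) complex.Re (w * expi2pi (dotp m x)) =
  (m == freq0)%:R * complex.Re w.
Proof.
have mc := @measurable_cube R d.
under eq_Rintegral do rewrite Re_expi2pi.
have iZ (a th : R) : P.-integrable (cube d)
    (EFin \o (fun x => a * cos (th + 2 * pi * dotp m x))).
  by under [_ \o _]eq_fun do rewrite /comp EFinM;
    apply: integrableZl => //; exact: integrable_cos.
rewrite RintegralD// !RintegralZl//; try exact: integrable_cos.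
by rewrite !Rintegral_cos cos0 cos_pihalf !mulr0 addr0 mulr1 mulrC.
Qed.

Lemma integrable_sum_seq (I : Type) (r : seq I) (h : I -> Rpoint R d -> R) :
  (forall i, P.-integrable (cube d) (EFin \o h i)) ->
  P.-integrable (cube d) (EFin \o (fun x => \sum_(i <- r) h i x)).
Proof.
move=> ih; elim: r => [|i r IH].
  under [_ \o _]eq_fun do rewrite /comp big_nil.
  exact: integrable_cst_cube.
under [_ \o _]eq_fun do rewrite /comp big_cons EFinD.
apply: integrableD => //; [exact: measurable_cube|exact: ih].
Qed.

Lemma Rintegral_sum_seq (I : Type) (r : seq I) (h : I -> Rpoint R d -> R) :
  (forall i, P.-integrable (cube d) (EFin \o h i)) ->
  \int[P]_(x in cube d) (\sum_(i <- r) h i x) =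
  \sum_(i <- r) \int[P]_(x in cube d) h i x.
Proof.
move=> ih; elim: r => [|i r IH].
  under eq_Rintegral do rewrite big_nil.
  by rewrite Rintegral_cst ?mul0r ?big_nil//; exact: measurable_cube.
under eq_Rintegral do rewrite big_cons.
rewrite RintegralD//; [by rewrite IH big_cons|exact: measurable_cube|].
exact: integrable_sum_seq.
Qed.

Definition trigpoly (s : seq (d.-tuple int)) (c : d.-tuple int -> R[i]) x : R[i] :=
  \sum_(k <- s) c k * expi2pi (dotp k x).

Lemma normc_sqr_conj (z : R[i]) : normc z ^+ 2 = complex.Re (z * conjc z).
Proof. by rewrite normc_sqr; case: z => a b /=; ring. Qed.

Lemma conjcM (z w : R[i]) : conjc (z * w) = conjc z * conjc w.
Proof. exact: (rmorphM conjc). Qed.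

Lemma conjc_sum (I : Type) (r : seq I) (F : I -> R[i]) :
  conjc (\sum_(i <- r) F i) = \sum_(i <- r) conjc (F i).
Proof. exact: (rmorph_sum conjc). Qed.

Lemma conj_expi2pi (t : R) : conjc (expi2pi t) = expi2pi (- t).
Proof. by rewrite /expi2pi /= mulrN cosN sinN. Qed.

Lemma Re_sum (I : Type) (r : seq I) (F : I -> R[i]) :
  complex.Re (\sum_(i <- r) F i) = \sum_(i <- r) complex.Re (F i).
Proof.
by elim: r => [|i r IH]; rewrite ?big_nil// !big_cons -IH;
  case: (F i) (\sum_(_ <- _) _) => [a b] [e f]. Qed.

Lemma normc_sqr_trigpoly s c x : normc (trigpoly s c x) ^+ 2 =
  \sum_(k <- s) \sum_(l <- s)
    complex.Re (c k * conjc (c l) * expi2pi (dotp (freqB k l) x)).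
Proof.
rewrite normc_sqr_conj /trigpoly conjc_sum mulr_suml Re_sum.
apply: eq_bigr => k _; rewrite mulr_sumr Re_sum; apply: eq_bigr => l _.
rewrite conjcM conj_expi2pi dotp_freqB expi2piD; congr complex.Re; ring.
Qed.

Lemma integrable_normc_sqr_trigpoly s c :
  P.-integrable (cube d) (EFin \o (fun x => normc (trigpoly s c x) ^+ 2)).
Proof.
under [_ \o _]eq_fun do rewrite /comp normc_sqr_trigpoly.
by do 2 apply: integrable_sum_seq => ?; exact: integrable_Re_expi2pi.
Qed.

(** Expanding |t|^2 as a double sum, orthogonality leaves the diagonal. *)
Lemma parseval_trigpoly s c : uniq s ->
  (\int[P]_(x in cube d) (normc (trigpoly s c x) ^+ 2)%:E =
   (\sum_(k <- s) normc (c k) ^+ 2)%:E)%E.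
Proof.
move=> us; rewrite -[LHS]fineK; last first.
  by apply: integrable_fin_num; [exact: measurable_cube|exact: integrable_normc_sqr_trigpoly].
congr (_%:E); rewrite -/(Rintegral _ _ _).
under eq_Rintegral do rewrite normc_sqr_trigpoly.
rewrite Rintegral_sum_seq; last first.
  by move=> k; apply: integrable_sum_seq => ?; exact: integrable_Re_expi2pi.
apply: eq_big_seq => k ks.
rewrite Rintegral_sum_seq; last by move=> l; exact: integrable_Re_expi2pi.
under eq_bigr do rewrite Rintegral_Re_expi2pi freqB_eq0.
rewrite (bigD1_seq k)//= eqxx mul1r normc_sqr_conj big1 ?addr0// => l lk.
by rewrite eq_sym (negbTE lk) mul0r.
Qed.

Lemma measurable_Re_trigpoly s c :
  measurable_fun setT (fun x => complex.Re (trigpoly s c x)).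
Proof.
under eq_fun do rewrite Re_sum; apply: measurable_sum => k.
under eq_fun do rewrite Re_expi2pi.
by apply: measurable_funD; apply: measurable_funM => //; exact: measurable_cos_dotp.
Qed.

End trigonometric_polynomials.

(** * Uniform approximation by Fourier partial sums *)

Section nonnegative_sums.
Variables (R : realType) (T : choiceType).
Implicit Types (g : T -> R) (s : seq T).

Lemma sum_le_esum g (S : R) s :
  (\esum_(k in [set: T]) (g k)%:E <= S%:E)%E -> uniq s ->
  \sum_(k <- s) g k <= S.
Proof.
move=> gS us; rewrite -lee_fin; apply: le_trans gS.
rewrite -sumEFin fsbig_seq//; apply: ereal_sup_ubound.
by exists [set` s] => //; split => //; exact: finite_seq.
Qed.

(** Any finite set whose sum is within [e] of the total leaves tails at most [e]. *)
Lemma esum_tail g (e : R) : (forall k, 0 <= g k) ->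
  (\esum_(k in [set: T]) (g k)%:E < +oo)%E -> 0 < e ->
  exists A : {fset T}, forall s, uniq s -> \sum_(k <- s | k \notin A) g k <= e.
Proof.
move=> g0 goo e0.
have gfin : (\esum_(k in [set: T]) (g k)%:E)%E \is a fin_num.
  by rewrite ge0_fin_numE// esum_ge0// => k _; rewrite lee_fin.
set S := fine (\esum_(k in [set: T]) (g k)%:E)%E.
have SE : (\esum_(k in [set: T]) (g k)%:E)%E = S%:E by rewrite fineK.
have : ((S - e)%:E < \esum_(k in [set: T]) (g k)%:E)%E.
  by rewrite SE lte_fin gtrBl.
move=> /ereal_sup_gt[_ [X [finX _] <-]].
rewrite fsbig_finite// sumEFin lte_fin => hX.
exists (fset_set X) => s us.
have : \sum_(k <- fset_set X ++ [seq k <- s | k \notin fset_set X]) g k <= S.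
  apply: sum_le_esum; first by rewrite SE.
  rewrite cat_uniq fset_uniq filter_uniq// andbT/= -all_predC.
  by apply/allP => k; rewrite mem_filter => /andP[].
rewrite big_cat/= big_filter; lra.
Qed.

End nonnegative_sums.

Lemma partial_sumE (I : choiceType) (V : zmodType) (F : I -> V) (A : {fset I}) :
  summability.partial_sum F A = \sum_(k <- A) F k.
Proof. by rewrite /summability.partial_sum big_seq_fsetE. Qed.

Section fourier_approximation.
Variables (R : realType) (d : nat).
Implicit Types (k : d.-tuple int) (x : Rpoint R d) (f : Rpoint R d -> R).
Local Notation freq0 := (freq0 d).

Lemma fourier_freq0 f : fourier f freq0 = (integ f)%:C.
Proof.
rewrite /fourier /cintegral /integ; apply/eqP; rewrite eq_complex/=; apply/andP; split.
  apply/eqP; apply: eq_Rintegral => x _.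
  by rewrite dotp_freq0 oppr0 mulr0 cos0 sin0 mulr1 mulr0 subr0.
under eq_Rintegral do rewrite dotp_freq0 oppr0 mulr0 cos0 sin0 mulr0 mul0r addr0.
by rewrite Rintegral_cst ?mul0r//; exact: measurable_cube.
Qed.

(** Absolute summability makes the approximation uniform: the tail of the
    coefficients bounds the error at every point.  Having the zero frequency in
    the set is what later separates the integral from the error. *)
Lemma fourier_approx f (e : R) : fourier_series f -> 0 < e ->
  exists2 A : {fset d.-tuple int}, freq0 \in A &
    forall x, cube d x -> normc (trigpoly A (fourier f) x - (f x)%:C) <= e.
Proof.
move=> [fsum fcvg] e0.
have e20 : 0 < e / 2 by rewrite divr_gt0.
have foo : (\esum_(k in [set: d.-tuple int]) (normc (fourier f k))%:E < +oo)%E.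
  move: fsum; rewrite /summable; congr (_ < _)%E; apply: eq_esum => k _.
  by rewrite gee0_abs// lee_fin normc_ge0.
have [A tailA] := esum_tail (fun k => normc_ge0 (fourier f k)) foo e20.
exists (freq0 |` A)%fset; first by rewrite !inE eqxx.
move=> x cx; set A' := (_ |` _)%fset.
have /= [B _ hB] := fcvg x cx (ball 0 (e / 2)) (nbhsx_ballx _ _ e20).
pose C := (A' `|` B)%fset.
have /= : [set C0 | (B `<=` C0)%fset] C by exact: fsubsetUr.
move=> /hB; rewrite /= /ball/= sub0r normrN ger0_norm ?normc_ge0//.
rewrite partial_sumE => hC.
rewrite /trigpoly.
have -> : \sum_(k <- A') fourier f k * expi2pi (dotp k x) =
   \sum_(k <- C) fourier f k * expi2pi (dotp k x) -
   \sum_(k <- C | k \notin A') fourier f k * expi2pi (dotp k x).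
  rewrite [X in _ = X - _](bigID (mem A'))/= addrK [RHS]big_fset_condE/=.
  apply: eq_fbigl => k; rewrite !inE/=.
  by case: (k == freq0); case: (k \in A); rewrite //= ?andbF.
rewrite addrAC; apply: le_trans (le_normcD _ _) _.
rewrite [e]splitr; apply: lerD; first exact: ltW.
rewrite normcN; apply: le_trans (le_normc_sum _ _ _) _.
apply: le_trans (tailA C (fset_uniq _)).
under eq_bigr do rewrite normcM normc_expi2pi mulr1.
rewrite [leRHS](bigID (fun k => k \notin A'))/=.
rewrite [X in X + _](eq_bigl (fun k => k \notin A')).
  by rewrite lerDl sumr_ge0// => k _; exact: normc_ge0.
move=> k; rewrite !inE negb_or; by case: (k \in A) => //=; rewrite ?andbT ?andbF.
Qed.

(** A uniform bound for all the trigonometric polynomials with frequencies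
    among those of [f]. *)
Lemma sum_normc_fourier f : fourier_series f -> exists2 G : R, 0 <= G &
  forall s, uniq s -> \sum_(k <- s) normc (fourier f k) <= G.
Proof.
move=> [fsum _].
have foo : (\esum_(k in [set: d.-tuple int]) (normc (fourier f k))%:E < +oo)%E.
  move: fsum; rewrite /summable; congr (_ < _)%E; apply: eq_esum => k _.
  by rewrite gee0_abs// lee_fin normc_ge0.
have f0 : (0 <= \esum_(k in [set: d.-tuple int]) (normc (fourier f k))%:E)%E.
  by apply: esum_ge0 => k _; rewrite lee_fin normc_ge0.
exists (fine (\esum_(k in [set: d.-tuple int]) (normc (fourier f k))%:E)%E).
  exact: fine_ge0.
by move=> s us; apply: sum_le_esum => //; rewrite fineK// ge0_fin_numE.
Qed.

End fourier_approximation.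

(** * Aliasing and the dual lattice *)

Section lattice_aliasing.
Variables (R : realType) (d N : nat).
Hypothesis N0 : (0 < N)%N.
Implicit Types (k : d.-tuple int) (x Delta : Rpoint R d) (f : Rpoint R d -> R)
  (z : d.-tuple 'I_N).
Local Notation frac := Defs.frac.
Local Notation shift := Defs.shift.
Local Notation freq0 := (freq0 d).

Definition dotz k z : int := \sum_(j < d) tnth k j * (tnth z j : nat)%:Z.
(** Membership of [k] in the dual lattice of the points generated by [z]. *)
Definition dual z k : bool := (N %| dotz k z)%Z.

Lemma dual_freq0 z : dual z freq0.
Proof. by rewrite /dual /dotz big1 ?dvdz0// => j _; rewrite tnth_mktuple mul0r. Qed.

Lemma frac_itv (x : R) : 0 <= frac x < 1.
Proof.
rewrite /frac subr_ge0 ltrBlDl; have /andP[-> h] := floor_itv x.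
by rewrite -[X in _ + X]/(1%:~R) -intrD.
Qed.

Lemma frac_id (x : R) : 0 <= x < 1 -> frac x = x.
Proof. by move=> x01; rewrite /frac (@floor_def _ _ 0) ?subr0// add0r. Qed.

Definition lattice_point z n : Rpoint R d :=
  [tuple frac ((n * tnth z j)%N%:R / N%:R) | j < d].
Definition shifted_point z Delta n : Rpoint R d :=
  [tuple frac (tnth (lattice_point z n) j + tnth Delta j) | j < d].
Definition origin : Rpoint R d := [tuple 0 | j < d].

Lemma cube_shifted_point z Delta n : cube d (shifted_point z Delta n).
Proof.
move=> j; rewrite tnth_mktuple.
by have /andP[-> /ltW] := frac_itv (tnth (lattice_point z n) j + tnth Delta j).
Qed.

(** Lets the results on shifted rules be used for the unshifted one. *)
Lemma shift_origin z : shift (lattice z) origin = lattice z :> seq (Rpoint R d).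
Proof.
rewrite /shift /lattice -map_comp; apply: eq_map => n /=.
apply: eq_from_tnth => j; rewrite !tnth_mktuple addr0.
exact/frac_id/frac_itv.
Qed.

Lemma qrule_shift z Delta f : qrule (shift (lattice z) Delta) f =
  N%:R^-1 * \sum_(0 <= n < N) f (shifted_point z Delta n).
Proof.
rewrite /qrule /shift /lattice !size_map size_iota !big_map.
by rewrite /index_iota subn0.
Qed.

(** The fractional parts drop out, since the frequencies are integers. *)
Lemma expi2pi_shifted_point k z Delta n :
  expi2pi (dotp k (shifted_point z Delta n)) =
  expi2pi (dotp k Delta) * expi2pi ((dotz k z)%:~R / N%:R) ^+ n.
Proof.
have N0R : (N%:R : R) != 0 by rewrite pnatr_eq0 -lt0n.
rewrite -expi2piMn -expi2piD.
pose a j := Num.floor ((n * tnth z j)%N%:R / N%:R : R).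
pose b j := Num.floor (tnth (lattice_point z n) j + tnth Delta j).
rewrite -[RHS](expi2piDz _ (- \sum_(j < d) tnth k j * (a j + b j))).
congr expi2pi; rewrite /dotp /dotz !rmorph_sum/= rmorphN/= !rmorph_sum/= mulr_suml !mulr_sumr.
rewrite -sumrN -!big_split/=; apply: eq_bigr => j _.
have -> : tnth (shifted_point z Delta n) j =
    (n * tnth z j)%N%:R / N%:R - (a j)%:~R + tnth Delta j - (b j)%:~R.
  by rewrite tnth_mktuple /frac -/(b j) {1}tnth_mktuple.
by rewrite !intrM intrD natrM; ring.
Qed.

(** Aliasing: the geometric sum over n keeps exactly the dual frequencies. *)
Lemma qrule_trigpoly s c z Delta :
  (N%:R^-1)%:C * \sum_(0 <= n < N) trigpoly s c (shifted_point z Delta n) =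
  trigpoly [seq k <- s | dual z k] c Delta :> R[i].
Proof.
rewrite /trigpoly exchange_big/= mulr_sumr big_filter [RHS]big_mkcond/=.
apply: eq_bigr => k _.
under eq_bigr do rewrite expi2pi_shifted_point.
rewrite -!mulr_sumr sum_expi2pi// -/(dual z k); case: (dual z k); last first.
  by rewrite mul0n mulr0 mulr0 mulr0.
have N0R : (N%:R : R) != 0 by rewrite pnatr_eq0 -lt0n.
have e : (N%:R^-1)%:C * (true * N)%:R = 1 :> R[i].
  by rewrite mul1n -(rmorph_nat (real_complex R)) -rmorphM/= mulVf.
move: e; set u := (_%:C); set v := (_%:R) => uv.
by rewrite [_ * v]mulrC !mulrA [u * _]mulrC -!mulrA [u * _]mulrA uv mul1r.
Qed.

(** The error is, up to sign, the dual part of the Fourier series without its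
    constant term; this is a statement about a finite part of that series. *)
Lemma lattice_error_approx f A (e : R) z Delta : fourier_series f ->
  freq0 \in A -> uniq A ->
  (forall x, cube d x -> normc (trigpoly A (fourier f) x - (f x)%:C) <= e) ->
  normc ((integ f - qrule (shift (lattice z) Delta) f)%:C +
     trigpoly [seq k <- A | (k != freq0) && dual z k] (fourier f) Delta) <= e.
Proof.
move=> fs zA uA hA; rewrite rmorphB/= -fourier_freq0.
have -> : fourier f freq0 - (qrule (shift (lattice z) Delta) f)%:C +
    trigpoly [seq k <- A | (k != freq0) && dual z k] (fourier f) Delta =
  (N%:R^-1)%:C * \sum_(0 <= n < N)
    (trigpoly A (fourier f) (shifted_point z Delta n)
       - (f (shifted_point z Delta n))%:C).
  rewrite sumrB mulrBr qrule_trigpoly qrule_shift rmorphM/= rmorph_sum/= addrAC.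
  congr (_ - _); rewrite /trigpoly !big_filter [RHS]big_mkcond.
  rewrite (bigD1_seq freq0)//= dual_freq0 dotp_freq0 expi2pi0 mulr1.
  by rewrite -big_mkcondr.
have NR : 0 < N%:R :> R by rewrite ltr0n.
rewrite normcM normc_real ger0_norm ?invr_ge0// ler_pdivrMl//.
apply: le_trans (le_normc_sum _ _ _) _.
apply: (@le_trans _ _ (\sum_(0 <= n < N) e)).
  by apply: ler_sum => n _; apply: hA; exact: cube_shifted_point.
by rewrite sumr_const_nat subn0 mulr_natl.
Qed.

End lattice_aliasing.

(** * Mean squared error over the shift *)

Section shifted_lattice_rule.
Variables (R : realType) (d : nat).
Implicit Types (f : Rpoint R d -> R).
Local Notation freq0 := (freq0 d).
Local Notation P := (@cube_prob R d).
Local Notation shift := Defs.shift.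

Lemma abs_error_le N (z : d.-tuple 'I_N) f A (e : R) Delta : (0 < N)%N ->
  fourier_series f -> freq0 \in A -> uniq A ->
  (forall x, cube d x -> normc (trigpoly A (fourier f) x - (f x)%:C) <= e) ->
  `|integ f - qrule (shift (lattice z) Delta) f| <=
    normc (trigpoly [seq k <- A | (k != freq0) && dual z k] (fourier f) Delta) + e.
Proof.
move=> N0 fs zA uA hA.
have := lattice_error_approx N0 z Delta fs zA uA hA.
set E := integ f - _; set t := trigpoly _ _ _ => h.
rewrite -normc_real -[E%:C](addrK t) addrC -(normcN t).
by apply: le_trans (le_normcD _ _) _; rewrite lerD2l.
Qed.

(** The error is a pointwise limit of trigonometric polynomials in the shift;
    nothing is known of [f] outside the cube. *)
Lemma measurable_error N (z : d.-tuple 'I_N) f : (0 < N)%N ->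
  fourier_series f ->
  measurable_fun (cube d) (fun Delta => integ f - qrule (shift (lattice z) Delta) f).
Proof.
move=> N0 fs.
have hn n : exists A : {fset d.-tuple int}, (freq0 \in A) &&
    `[< forall x, cube d x ->
      normc (trigpoly A (fourier f) x - (f x)%:C) <= n.+1%:R^-1 >].
  have [A zA hA] := @fourier_approx R d f n.+1%:R^-1 fs ltac:(by rewrite invr_gt0).
  by exists A; rewrite zA; apply/asboolP.
pose A n : {fset d.-tuple int} := xchoose (hn n).
have AP n : (freq0 \in A n) && `[< forall x, cube d x ->
      normc (trigpoly (A n) (fourier f) x - (f x)%:C) <= n.+1%:R^-1 >].
  exact: (xchooseP (hn n)).
pose h n x := - complex.Re
  (trigpoly [seq k <- A n | (k != freq0) && dual z k] (fourier f) x).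
apply: (@measurable_fun_cvg _ _ _ _ h) => [n|x cx].
  by apply: measurable_funTS; apply: measurableT_comp => //; exact: measurable_Re_trigpoly.
apply/cvgrPdist_le => eps e0; near=> n.
apply: (@le_trans _ _ n.+1%:R^-1); last first.
  by near: n; have := near_infty_natSinv_lt (PosNum e0); apply: filterS => n /ltW.
have /andP[zA /asboolP hA] := AP n.
have := lattice_error_approx N0 z x fs zA (fset_uniq _) hA.
apply: le_trans; apply: le_trans (le_normc_Re _).
by rewrite /h opprK; case: (trigpoly _ _ _).
Unshelve. all: by end_near. Qed.

(** Parseval's identity for the shift-averaged error.  One finite set of
    frequencies serves all N and z, so that the later averages are finite sums
    of real numbers and [e] is the only limit left. *)
Lemma integral_sqr_error_le f (e : R) : fourier_series f -> 0 < e ->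
  exists A : {fset d.-tuple int}, forall N (z : d.-tuple 'I_N), (0 < N)%N ->
    (\int[P]_(Delta in cube d)
      (`|integ f - qrule (shift (lattice z) Delta) f| ^+ 2)%:E <=
    (\sum_(k <- A | (k != freq0) && dual z k) normc (fourier f k) ^+ 2 + e)%:E)%E.
Proof.
move=> fs e0; have [G G0 hG] := sum_normc_fourier fs.
(* |t| <= G gives (|t| + e1)^2 <= |t|^2 + e1 (2 G + e1) <= |t|^2 + e. *)
pose e1 := Num.min 1 (e / (2 * G + 1)).
have e10 : 0 < e1 by rewrite lt_min ltr01 divr_gt0// ltr_wpDl// mulr_ge0.
have e1e : e1 * (2 * G + e1) <= e.
  have G1 : 0 < 2 * G + 1 by rewrite ltr_wpDl// mulr_ge0.
  have h1 : e1 <= e / (2 * G + 1) by rewrite ge_min lexx orbT.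
  have h2 : e1 <= 1 by rewrite ge_min lexx.
  apply: (@le_trans _ _ (e / (2 * G + 1) * (2 * G + 1))); last by rewrite divfK// gt_eqF.
  by apply: ler_pM => //; [exact: ltW|rewrite addr_ge0 ?mulr_ge0// ltW|rewrite lerD2l].
have [A zA hA] := fourier_approx fs e10.
exists A => N z N0.
set s := [seq k <- A | (k != freq0) && dual z k].
have us : uniq s by apply: filter_uniq; exact: fset_uniq.
apply: (@le_trans _ _ (\int[P]_(x in cube d) (normc (trigpoly s (fourier f) x) ^+ 2 + e)%:E)%E).
  apply: ge0_le_integral; first exact: measurable_cube.
  - by move=> x _; rewrite lee_fin sqr_ge0.
  - apply/measurable_EFinP; apply: measurable_funX; apply: measurableT_comp => //.
    exact: measurable_error.
  - apply/measurable_EFinP; apply: measurable_funD => //.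
    by have /measurable_int/measurable_EFinP := integrable_normc_sqr_trigpoly s (fourier f).
  - move=> x _; rewrite lee_fin.
    have := abs_error_le z x N0 fs zA (fset_uniq _) hA; rewrite -/s.
    set t := trigpoly s _ x => ht.
    have tG : normc t <= G.
      apply: le_trans (le_normc_sum _ _ _) _; apply: le_trans (hG s us).
      by apply: ler_sum => k _; rewrite normcM normc_expi2pi mulr1.
    have t0 := normc_ge0 t.
    apply: (@le_trans _ _ ((normc t + e1) ^+ 2)).
      by rewrite ler_pXn2r ?nnegrE// addr_ge0// ltW.
    rewrite sqrrD -addrA lerD2l; apply: le_trans e1e.
    rewrite -mulr_natl; nra.
under eq_integral do rewrite EFinD.
rewrite integralD//=.
- rewrite parseval_trigpoly// integral_cst//=; last exact: measurable_cube.
  by rewrite [X in (_ * X)%E]cube_prob_cube mule1 /s big_filter.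
- exact: measurable_cube.
- exact: integrable_normc_sqr_trigpoly.
- exact: integrable_cst_cube.
Qed.

End shifted_lattice_rule.

(** * Korobov weights *)

Section korobov_weights.
Variables (R : realType) (d : nat) (alpha : R) (gamma : nat -> R).
Hypothesis alpha0 : 0 < alpha.
Hypothesis gamma01 : forall j, 0 <= gamma j <= 1.
Implicit Types (k : d.-tuple int) (f : Rpoint R d -> R).
Local Notation rfun := (rfun alpha gamma).

Definition weight1 (j : nat) (m : int) : R :=
  if m == 0 then 1 else gamma j / `|m%:~R| `^ alpha.

(** This is 1 / r(k), with value 0 where r(k) is infinite. *)
Definition weight k : R := \prod_(j < d) weight1 j (tnth k j).

Lemma norm_int_ge1 (m : int) : m != 0 -> 1 <= `|m%:~R| :> R.
Proof. by move=> m0; rewrite -intr_norm -[1]/(1%:~R) ler_int; lia. Qed.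

Lemma powR_int_ge1 (m : int) (a : R) : 0 <= a -> m != 0 -> 1 <= `|m%:~R| `^ a :> R.
Proof.
move=> a0 m0; apply: (@le_trans _ _ (1 `^ a)); first by rewrite powR1.
by rewrite ge0_ler_powR ?nnegrE ?norm_int_ge1.
Qed.

Lemma weight1_ge0 j m : 0 <= weight1 j m.
Proof.
rewrite /weight1; case: ifP => // _.
by have /andP[g0 _] := gamma01 j; rewrite divr_ge0// powR_ge0.
Qed.

Lemma weight1_le1 j m : weight1 j m <= 1.
Proof.
rewrite /weight1; case: eqP => // /eqP m0.
have /andP[g0 g1] := gamma01 j.
have h := powR_int_ge1 (ltW alpha0) m0.
by rewrite ler_pdivrMr ?mul1r ?(le_trans g1)// (lt_le_trans _ h).
Qed.

Lemma weight_ge0 k : 0 <= weight k.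
Proof. by apply: prodr_ge0 => j _; exact: weight1_ge0. Qed.

Lemma prod_le1 (I : Type) (r : seq I) (Q : pred I) (F : I -> R) :
  (forall i, 0 <= F i <= 1) -> \prod_(i <- r | Q i) F i <= 1.
Proof.
move=> F01; elim/big_rec: _ => // i x _ x1; have /andP[F0 F1] := F01 i.
by apply: le_trans (ler_wpM2l F0 x1) _; rewrite mulr1.
Qed.

Lemma weight_le1 k : weight k <= 1.
Proof. by apply: prod_le1 => j; rewrite weight1_ge0 weight1_le1. Qed.

Lemma weight_le k (j : 'I_d) : tnth k j != 0 ->
  weight k <= (`|(tnth k j)%:~R| `^ alpha)^-1.
Proof.
move=> kj; rewrite /weight (bigD1 j)//=.
have p1 : \prod_(i < d | i != j) weight1 i (tnth k i) <= 1.
  by apply: prod_le1 => i; rewrite weight1_ge0 weight1_le1.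
apply: le_trans (ler_wpM2l (weight1_ge0 _ _) p1) _.
rewrite mulr1 /weight1 (negbTE kj) ler_piMl// ?invr_ge0 ?powR_ge0//.
by have /andP[] := gamma01 j.
Qed.

Lemma rfun_gt0 k : 0 < weight k -> rfun k = (weight k)^-1%:E.
Proof.
move=> w0; rewrite /rfun /weight -prodfV -prodEFin big_mkcond.
apply: eq_bigr => j _.
have : weight1 j (tnth k j) != 0.
  apply: contraTneq w0 => w10.
  by rewrite /weight (bigD1 j)//= w10 mul0r ltxx.
rewrite /weight1; have [_ _|_] /= := eqVneq (tnth k j) 0; first by rewrite invr1.
by rewrite mulf_eq0 negb_or => /andP[/negbTE-> _]; rewrite invf_div.
Qed.

Lemma rfun_eqy k : weight k = 0 -> rfun k = +oo%E.
Proof.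
move/eqP; rewrite /weight prodf_seq_eq0 => /hasP[j _]; rewrite /weight1/=.
have [_|kj] := eqVneq (tnth k j) 0; first by rewrite oner_eq0.
rewrite mulf_eq0 invr_eq0 => /orP[/eqP gj|]; last first.
  by rewrite gt_eqF// (lt_le_trans _ (powR_int_ge1 (ltW alpha0) kj)).
rewrite /rfun (bigD1 j)//= gj eqxx gt0_mulye//.
elim/big_ind: _ => [|x y|i /andP[ki _]]; [by rewrite lte01|exact: mule_gt0|].
have [_|gi] := eqVneq (gamma i) 0; rewrite ?lt0y// lte_fin divr_gt0//.
  by rewrite (lt_le_trans _ (powR_int_ge1 (ltW alpha0) ki)).
by rewrite lt_neqAle eq_sym gi; have /andP[] := gamma01 i.
Qed.

(** The numbers u_k = |c_k|^2 r(k)^2 are the summands of the squared norm; where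
    r(k) is infinite both c_k and the weight vanish, and u_k = 0 will do. *)
Lemma unit_ballP f : unit_ball alpha gamma f ->
  fourier_series f /\ exists u : d.-tuple int -> R,
  [/\ forall k, 0 <= u k,
      forall k, normc (fourier f k) ^+ 2 = weight k ^+ 2 * u k &
      forall s, uniq s -> \sum_(k <- s) u k <= 1].
Proof.
move=> [[_ fs foo _] f1]; split => //.
pose u k := if weight k == 0 then 0 else normc (fourier f k) ^+ 2 / weight k ^+ 2.
have uE k : ((normc (fourier f k))%:E ^+ 2 * rfun k ^+ 2)%E = (u k)%:E.
  rewrite /u; have [w0|w0] := eqVneq (weight k) 0.
    by rewrite (foo _ (rfun_eqy w0)) normc0 expe2 mule0 mul0e.
  rewrite rfun_gt0 ?lt_neqAle 1?eq_sym ?w0 ?weight_ge0//.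
  by rewrite -!EFin_expe -EFinM exprVn.
exists u; split.
- by move=> k; rewrite /u; case: ifP => // _; rewrite divr_ge0// sqr_ge0.
- move=> k; rewrite /u; have [w0|w0] := eqVneq (weight k) 0.
    by rewrite mulr0 (foo _ (rfun_eqy w0)) normc0 expr0n.
  by rewrite mulrCA mulfV ?mulr1// expf_neq0.
move=> s us; apply: sum_le_esum => //.
have n0 : (0 <= norm_sqr alpha gamma f)%E.
  rewrite /norm_sqr; apply: esum_ge0 => k _; rewrite [leRHS]uE lee_fin /u.
  by case: ifP => // _; rewrite divr_ge0// sqr_ge0.
have : (norm_sqr alpha gamma f <= 1)%E.
  rewrite -lee_sqrt ?lee01//; apply: le_trans f1 _.
  by rewrite /sqrte sqrtr1.
by rewrite /norm_sqr (eq_esum (fun k _ => uE k)).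
Qed.

End korobov_weights.

(** * Worst-case error of a lattice rule *)

Section worst_case_error_upper.
Variables (R : realType) (d : nat) (alpha : R) (gamma : nat -> R).
Hypothesis alpha0 : 0 < alpha.
Hypothesis gamma01 : forall j, 0 <= gamma j <= 1.
Implicit Types (k : d.-tuple int) (f : Rpoint R d -> R).
Local Notation freq0 := (freq0 d).
Local Notation weight := (@weight R d alpha gamma).

(** With v = w^(1/lambda) this is the inequality between the l^1 norm and the
    l^(2 lambda) norm of v: as every v_i is at most T and 2 lambda >= 1, each
    w_i^2 = v_i^(2 lambda) is at most T^(2 lambda - 1) v_i. *)
Lemma sum_sqr_le_powR (I : eqType) (s : seq I) (w : I -> R) (lambda T : R) :
  2^-1 <= lambda -> (forall i, 0 <= w i) ->
  \sum_(i <- s) w i `^ lambda^-1 <= T -> \sum_(i <- s) w i ^+ 2 <= (T `^ lambda) ^+ 2.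
Proof.
move=> l2 w0 hT.
have l0 : 0 < lambda by apply: lt_le_trans l2; rewrite invr_gt0.
have T0 : 0 <= T by apply: le_trans hT; apply: sumr_ge0 => i _; exact: powR_ge0.
have TE : (T `^ lambda) ^+ 2 = T `^ (2 * lambda).
  by rewrite -powR_mulrn ?powR_ge0// -powRrM mulrC.
have vT i : i \in s -> w i `^ lambda^-1 <= T.
  move=> si; apply: le_trans hT; rewrite (big_rem i si)/= lerDl.
  by apply: sumr_ge0 => j _; exact: powR_ge0.
have wi i : i \in s -> w i ^+ 2 <= T `^ (2 * lambda - 1) * w i `^ lambda^-1.
  move=> si; have [->|wi0] := eqVneq (w i) 0.
    by rewrite expr0n/= mulr_ge0 ?powR_ge0.
  have wp : 0 < w i by rewrite lt_neqAle eq_sym wi0 w0.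
  have -> : w i ^+ 2 = (w i `^ lambda^-1) `^ (2 * lambda - 1) * w i `^ lambda^-1.
    have v0 : 0 < w i `^ lambda^-1 by rewrite powR_gt0.
    rewrite -[X in _ * X](powRr1 (ltW v0)) -powRD; last by rewrite (gt_eqF v0) implybT.
    rewrite subrK -powRrM mulrCA mulVf ?gt_eqF// mulr1.
    by rewrite -powR_mulrn// ltW.
  rewrite ler_wpM2r ?powR_ge0// ge0_ler_powR ?nnegrE ?powR_ge0 ?vT//.
  by rewrite subr_ge0 -ler_pdivrMl// mulr1.
apply: (@le_trans _ _ (\sum_(i <- s) T `^ (2 * lambda - 1) * w i `^ lambda^-1)).
  by rewrite big_seq [leRHS]big_seq; apply: ler_sum.
rewrite -mulr_sumr TE.
apply: le_trans (ler_wpM2l (powR_ge0 _ _) hT) _.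
have [->|Tn0] := eqVneq T 0; first by rewrite mulr0 powR_ge0.
rewrite -{2}(powRr1 T0) -powRD ?subrK//.
by rewrite Tn0 implybT.
Qed.

(** Cauchy-Schwarz for |c_k| = w(k) sqrt(u_k), in the form
    w sqrt u <= (w^2 / B + B u) / 2, which needs only the two separate sums. *)
Lemma ewor_le N (z : d.-tuple 'I_N) (lambda T : R) : (0 < N)%N ->
  2^-1 <= lambda -> 0 < T ->
  (forall s, uniq s -> all (fun k => (k != freq0) && dual z k) s ->
     \sum_(k <- s) weight k `^ lambda^-1 <= T) ->
  (ewor alpha gamma (lattice z : seq (Rpoint R d)) <= (T `^ lambda)%:E)%E.
Proof.
move=> N0 l2 T0 hT; apply: ge_ereal_sup => _ [f uf <-].
have [fs [u [u0 uE us]]] := unit_ballP alpha0 gamma01 uf.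
rewrite lee_fin; apply/ler_addgt0Pr => e e0.
have [A zA hA] := fourier_approx fs e0.
rewrite -shift_origin; apply: le_trans (abs_error_le z _ N0 fs zA (fset_uniq _) hA) _.
rewrite lerD2r; set s := [seq _ <- _ | _].
have us' : uniq s by apply: filter_uniq; exact: fset_uniq.
have sB := sum_sqr_le_powR l2 (weight_ge0 alpha gamma01) (hT s us' (filter_all _ _)).
apply: le_trans (le_normc_sum _ _ _) _.
set B := T `^ lambda in sB *.
have B0 : 0 < B by rewrite powR_gt0.
(* The arithmetic-geometric mean inequality, balanced at B. *)
apply: (@le_trans _ _ (\sum_(k <- s) (2^-1 * (weight k ^+ 2 / B) + 2^-1 * (B * u k)))).
  apply: ler_sum => k _; rewrite normcM normc_expi2pi mulr1.
  have := uE k; have := weight_ge0 alpha gamma01 k; have := u0 k; have := normc_ge0 (fourier f k).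
  move: (normc _) (weight k) (u k) => c w v c0 v0 w0 cE.
  have -> : c = w * Num.sqrt v.
    apply/eqP; rewrite -(@eqrXn2 _ 2)// ?mulr_ge0 ?sqrtr_ge0//.
    by rewrite exprMn sqr_sqrtr// cE.
  rewrite -{2}(sqr_sqrtr v0); set q := Num.sqrt v.
  have -> : 2^-1 * (w ^+ 2 / B) + 2^-1 * (B * q ^+ 2) =
     w * q + 2^-1 * ((w - B * q) ^+ 2 / B) by field; rewrite gt_eqF.
  by rewrite lerDl mulr_ge0// divr_ge0 ?sqr_ge0// ltW.
rewrite big_split/= -!mulr_sumr -mulr_suml.
have h1 : (\sum_(k <- s) weight k ^+ 2) / B <= B by rewrite ler_pdivrMr// -expr2.
have h2 : B * \sum_(k <- s) u k <= B by rewrite ler_piMr ?us// ltW.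
lra.
Qed.

End worst_case_error_upper.

Lemma esum_supported (R : realType) (T : choiceType) (A : {fset T}) (g : T -> R) :
  (forall k, 0 <= g k) -> (forall k, k \notin A -> g k = 0) ->
  (\esum_(k in [set: T]) (g k)%:E = (\sum_(k <- A) g k)%:E)%E.
Proof.
move=> g0 gA; transitivity (\esum_(k in [set` A]) (g k)%:E)%E.
  rewrite [RHS]esum_mkcond; apply: eq_esum => k _; case: ifPn => //.
  by rewrite notin_setE/= => /negP /gA ->.
rewrite esum_fset; last 2 first.
- exact: finite_fset.
- by move=> k _; rewrite lee_fin.
by rewrite -fsbig_seq// sumEFin.
Qed.

Section worst_case_error_lower.
Variables (R : realType) (d : nat) (alpha : R) (gamma : nat -> R).
Hypothesis alpha0 : 0 < alpha.
Hypothesis gamma01 : forall j, 0 <= gamma j <= 1.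
Implicit Types (k l m : d.-tuple int) (x : Rpoint R d).
Local Notation freq0 := (freq0 d).
Local Notation weight := (@weight R d alpha gamma).
Local Notation P := (@cube_prob R d).

Definition freqN k := freqB freq0 k.

Lemma weight_freqN k : weight (freqN k) = weight k.
Proof.
rewrite /weight; apply: eq_bigr => j _.
by rewrite /weight1 !tnth_mktuple sub0r oppr_eq0 rmorphN normrN.
Qed.

(** Imaginary parts are real parts after a rotation by - i. *)
Lemma Im_expi2pi (w : R[i]) (t : R) : complex.Im (w * expi2pi t) =
  complex.Re ((w * (- 'i)%C) * expi2pi t).
Proof. by case: w => a b /=; ring. Qed.

Lemma Im_sum (I : Type) (r : seq I) (F : I -> R[i]) :
  complex.Im (\sum_(i <- r) F i) = \sum_(i <- r) complex.Im (F i).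
Proof.
by elim: r => [|i r IH]; rewrite ?big_nil// !big_cons -IH;
  case: (F i) (\sum_(_ <- _) _) => [a b] [e f].
Qed.

Lemma cintegral_trigpoly s c :
  cintegral (cube d) (trigpoly s c : Rpoint R d -> R[i]) =
  \sum_(k <- s) (k == freq0)%:R * c k.
Proof.
rewrite /cintegral /trigpoly.
apply/eqP; rewrite eq_complex/=; apply/andP; split; apply/eqP.
  rewrite Re_sum; under eq_Rintegral do rewrite Re_sum.
  rewrite Rintegral_sum_seq; last by move=> k; exact: integrable_Re_expi2pi.
  apply: eq_bigr => k _; rewrite Rintegral_Re_expi2pi.
  by case: (k == freq0); rewrite ?mul1r ?mul0r.
rewrite Im_sum; under eq_Rintegral do rewrite Im_sum.
under eq_Rintegral do under eq_bigr do rewrite Im_expi2pi.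
rewrite Rintegral_sum_seq; last by move=> k; exact: integrable_Re_expi2pi.
apply: eq_bigr => k _; rewrite Rintegral_Re_expi2pi.
case: (k == freq0); rewrite ?mul1r ?mul0r//.
by case: (c k) => a b /=; ring.
Qed.

(** The test function for the frequency [k]; its squared norm is 1/2 when [k] is
    nonzero and has positive weight. *)
Definition cos_wave k x : R := weight k * cos (2 * pi * dotp k x).

Lemma cos_waveE k x : (cos_wave k x)%:C =
  (weight k / 2)%:C * expi2pi (dotp k x) + (weight k / 2)%:C * expi2pi (dotp (freqN k) x).
Proof.
rewrite dotp_freqB dotp_freq0 sub0r /cos_wave /expi2pi mulrN cosN sinN.
by apply/eqP; rewrite eq_complex/=; apply/andP; split; apply/eqP; field.
Qed.

Lemma fourier_cos_wave k l : fourier (cos_wave k) l =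
  ((weight k / 2) * ((l == k)%:R + (l == freqN k)%:R))%:C.
Proof.
rewrite /fourier.
have -> : (fun x => (cos_wave k x)%:C * expi2pi (- dotp l x)) =
    trigpoly [:: freqB k l; freqB (freqN k) l] (fun=> (weight k / 2)%:C).
  apply/funext => x; rewrite /trigpoly big_cons big_seq1 cos_waveE mulrDl.
  by rewrite (dotp_freqB k l) (dotp_freqB (freqN k) l) -!mulrA -!expi2piD.
rewrite cintegral_trigpoly big_cons big_seq1 !freqB_eq0 -mulrDl.
rewrite [RHS](rmorphM (real_complex R))/= mulrC; congr (_ * _).
by rewrite rmorphD/= !rmorph_nat (eq_sym k) (eq_sym (freqN k)).
Qed.

Lemma freqN_neq k : k != freq0 -> freqN k != k.
Proof.
apply: contraNneq => kk; apply/eqP/eq_from_tnth => j.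
have := congr1 (fun t => tnth t j) kk; rewrite !tnth_mktuple.
by move: (tnth k j) => m; clear; rewrite sub0r; lia.
Qed.

Lemma freqN_neq0 k : k != freq0 -> freqN k != freq0.
Proof.
apply: contraNneq => kk; apply/eqP/eq_from_tnth => j.
have := congr1 (fun t => tnth t j) kk; rewrite !tnth_mktuple.
by move: (tnth k j) => m; clear; rewrite sub0r; lia.
Qed.

Lemma normc_fourier_cos_wave k l : k != freq0 ->
  normc (fourier (cos_wave k) l) = if l \in [fset k; freqN k]%fset then weight k / 2 else 0.
Proof.
move=> k0; have w0 : 0 <= weight k / 2 by rewrite divr_ge0// weight_ge0.
rewrite fourier_cos_wave normc_real !inE.
have [->|lk] := eqVneq l k.
  by rewrite eq_sym (negbTE (freqN_neq k0)) addr0 mulr1 ger0_norm.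
have [_|_] /= := eqVneq l (freqN k); first by rewrite add0r mulr1 ger0_norm.
by rewrite addr0 mulr0 normr0.
Qed.

Lemma cos_wave_unit_ball k : k != freq0 -> 0 < weight k ->
  unit_ball alpha gamma (cos_wave k).
Proof.
move=> k0 w0.
pose A := [fset k; freqN k]%fset.
have kA : k \notin [fset freqN k]%fset by rewrite !inE eq_sym freqN_neq.
have wl l : l \in A -> weight l = weight k.
  by rewrite !inE => /orP[|] /eqP ->//; rewrite weight_freqN.
have nE : norm_sqr alpha gamma (cos_wave k) = (2^-1)%:E.
  rewrite /norm_sqr (eq_esum (b := fun l => (if l \in A then 4^-1 else 0)%:E)); last first.
    move=> l _; rewrite normc_fourier_cos_wave// -/A; case: ifP => [lA|_].
      rewrite rfun_gt0 ?wl// -!EFin_expe -EFinM; congr (_%:E).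
      by field; rewrite gt_eqF.
    by rewrite expe2 mule0 mul0e.
  rewrite (@esum_supported _ _ A); last 2 first.
  - by move=> l; case: ifP.
  - by move=> l /negbTE ->.
  by rewrite big_fsetU1// big_seq_fset1 !inE !eqxx orbT/=; congr (_%:E); field.
split; last first.
  rewrite /korobov_norm nE /sqrte lee_fin -[leRHS]sqrtr1 ler_wsqrtr//; lra.
split.
- move=> j x y cx cy xj yj xy; rewrite /cos_wave.
  have -> : dotp k y = dotp k x + (tnth k j)%:~R.
    rewrite /dotp (bigD1 j)//= [in RHS](bigD1 j)//= xj yj mulr1 mulr0 add0r addrC.
    by congr (_ + _); apply: eq_bigr => i ij; rewrite xy.
  by rewrite (mulrDr (2 * pi) (dotp k x)) cosD2piz.
- split.
    rewrite /summable (eq_esum (b := fun l => (if l \in A then weight k / 2 else 0)%:E)).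
      rewrite (@esum_supported _ _ A) ?ltry//.
      - by move=> l; case: ifP => // _; rewrite divr_ge0// ltW.
      - by move=> l /negbTE ->.
    move=> l _; rewrite gee0_abs ?lee_fin ?normc_ge0//.
    by rewrite normc_fourier_cos_wave.
  move=> x cx U /nbhs_singleton U0; exists A => // B /= AB.
  rewrite partial_sumE.
  have -> : \sum_(l <- B) fourier (cos_wave k) l * expi2pi (dotp l x) = (cos_wave k x)%:C.
    rewrite -(big_fset_incl _ AB); last first.
      move=> l _ lA; have := normc_fourier_cos_wave l k0; rewrite -/A (negbTE lA).
      by move=> /eq0_normc ->; rewrite mul0r.
    rewrite big_fsetU1// big_seq_fset1 cos_waveE !fourier_cos_wave !eqxx.
    by rewrite (negbTE (freqN_neq k0)) eq_sym (negbTE (freqN_neq k0)) addr0 add0r mulr1.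
  by rewrite subrr normc0.
- move=> l; have := normc_fourier_cos_wave l k0; case: ifPn => [lA _|_].
    by rewrite rfun_gt0 ?wl.
  by move=> /eq0_normc.
- by rewrite nE ltry.
Qed.

(** The wave has integral 0, while on the lattice points its phase is always a
    multiple of 2 pi, so that the rule returns w(k). *)
Lemma weight_le_ewor N (z : d.-tuple 'I_N) k : (0 < N)%N ->
  k != freq0 -> dual z k -> 0 < weight k ->
  ((weight k)%:E <= ewor alpha gamma (lattice z : seq (Rpoint R d)))%E.
Proof.
move=> N0 k0 kz wp.
apply: ereal_sup_ubound; exists (cos_wave k); first exact: cos_wave_unit_ball.
congr (_%:E).
have -> : integ (cos_wave k) = 0.
  apply: (@complexI R); rewrite -fourier_freq0 fourier_cos_wave.
  by rewrite eq_sym (negbTE k0) eq_sym (negbTE (freqN_neq0 k0)) addr0 mulr0.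
have -> : qrule (lattice z) (cos_wave k) = weight k.
  rewrite -shift_origin qrule_shift.
  rewrite (eq_bigr (fun=> weight k)) => [|n _].
    by rewrite sumr_const_nat subn0 -[X in _ * X]mulr_natl mulKf// pnatr_eq0 -lt0n.
  rewrite /cos_wave -[cos _]/(complex.Re (expi2pi _)) (expi2pi_shifted_point N0).
  have -> : dotp k (origin R d) = 0 by rewrite /dotp big1// => j _; rewrite tnth_mktuple mulr0.
  case/dvdzP: kz => q ->.
  have N0R : (N%:R : R) != 0 by rewrite pnatr_eq0 -lt0n.
  by rewrite intrM mulfK// -[q%:~R]add0r expi2piDz expi2pi0 expr1n mulr1 /= mulr1.
by rewrite sub0r normrN ger0_norm// weight_ge0.
Qed.

End worst_case_error_lower.

(** * Partial sums of the zeta function *)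

Lemma ler_sum_subseq (R : numDomainType) (I : eqType) (s A : seq I) (F : I -> R) :
  uniq s -> {subset s <= A} -> (forall i, 0 <= F i) ->
  \sum_(i <- s) F i <= \sum_(i <- A) F i.
Proof.
elim: A s => [|a A IH] s us sA F0.
  by case: s sA us => [//|x s] /(_ x); rewrite inE eqxx => /(_ isT).
rewrite big_cons; have [as_|as_] := boolP (a \in s).
  rewrite (big_rem a as_)/= lerD2l; apply: IH => //; first exact: rem_uniq.
  move=> i; rewrite (mem_rem_uniq _ us) !inE => /andP[ia /sA].
  by rewrite inE (negbTE ia).
rewrite -[leLHS]add0r lerD// IH// => i si; have := sA i si.
by rewrite inE => /predU1P[ia|//]; rewrite -ia si in as_.
Qed.

Section zeta_bounds.
Variables (R : realType) (s : R).
Hypothesis s1 : 1 < s.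

Lemma nondecreasing_series_riemannR : nondecreasing_seq (series (@riemannR R s)).
Proof.
apply/nondecreasing_seqP => n; rewrite /series/= big_nat_recr//= lerDl.
by rewrite invr_ge0 powR_ge0.
Qed.

Lemma dyadic_ratio_lt1 : 2 `^ (1 - s) < 1 :> R.
Proof.
have -> : 1 - s = - (s - 1) by ring.
rewrite powRN invf_lt1 ?powR_gt0//.
apply: (@le_lt_trans _ _ (1 `^ (s - 1))); first by rewrite powR1.
by rewrite gt0_ltr_powR ?nnegrE ?subr_gt0// ltr1n.
Qed.

(** Cauchy condensation: the 2^j terms from 2^j to 2^(j+1) - 1 sum to at most
    2^(j (1 - s)). *)
Lemma series_riemannR_dyadic (m : nat) (q := 2 `^ (1 - s) : R) :
  series (riemannR s) (2 ^ m).-1 <= (1 - q ^+ m) / (1 - q).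
Proof.
have q1 : q < 1 := dyadic_ratio_lt1.
have pm n : (2 ^ n)%:R * ((2 ^ n)%:R `^ s)^-1 = q ^+ n :> R.
  have e2 : 2 ^+ n = 2 `^ n%:R :> R by rewrite powR_mulrn.
  rewrite natrX e2 -powR_mulrn ?powR_ge0// /q -!powRrM -powRN.
  by rewrite -powRD ?pnatr_eq0 ?implybT//; congr (_ `^ _); ring.
elim: m => [|m IH]; first by rewrite /series/= big_geq// expr0 subrr mul0r.
have e0 : (0 < 2 ^ m)%N by rewrite expn_gt0.
rewrite /series/= (@big_cat_nat _ _ _ (2 ^ m).-1)//=; last by rewrite expnS; lia.
have -> : (1 - q ^+ m.+1) / (1 - q) = (1 - q ^+ m) / (1 - q) + q ^+ m.
  by rewrite exprS; field; lra.
apply: lerD; first exact: IH.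
apply: (@le_trans _ _ (\sum_((2 ^ m).-1 <= k < (2 ^ m.+1).-1) ((2 ^ m)%:R `^ s)^-1)).
  rewrite big_nat_cond [leRHS]big_nat_cond; apply: ler_sum => k /andP[/andP[mk _] _].
  rewrite lef_pV2 ?posrE ?powR_gt0 ?ltr0n// ge0_ler_powR ?nnegrE//.
    by apply: ltW; apply: lt_trans s1.
  by rewrite ler_nat; lia.
rewrite sumr_const_nat (_ : ((2 ^ m.+1).-1 - (2 ^ m).-1)%N = (2 ^ m)%N); last by rewrite expnS; lia.
by rewrite -[leLHS]mulr_natl pm.
Qed.

Lemma series_riemannR_le_zeta n : series (riemannR s) n <= zeta s.
Proof.
apply: nondecreasing_cvgn_le; first exact: nondecreasing_series_riemannR.
apply: nondecreasing_is_cvgn; first exact: nondecreasing_series_riemannR.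
exists (1 - 2 `^ (1 - s))^-1 => _ [m _ <-].
apply: (@le_trans _ _ (series (riemannR s) (2 ^ m).-1)).
  by apply: nondecreasing_series_riemannR; have := ltn_expl m (isT : (1 < 2)%N); lia.
apply: le_trans (series_riemannR_dyadic m) _.
have q1 := dyadic_ratio_lt1.
have i0 : 0 < (1 - 2 `^ (1 - s))^-1 by rewrite invr_gt0 subr_gt0.
by rewrite -[leRHS]mul1r (ler_pM2r i0) gerBl exprn_ge0// powR_ge0.
Qed.

Lemma sum_riemannR_le_zeta (t : seq nat) : uniq t ->
  \sum_(n <- t) riemannR s n <= zeta s.
Proof.
move=> ut; apply: le_trans (series_riemannR_le_zeta (\max_(n <- t) n).+1).
rewrite /series/=; apply: ler_sum_subseq => //.
  by move=> n nt; rewrite mem_index_iota ltnS/=; apply: leq_bigmax_seq.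
by move=> n; rewrite /riemannR invr_ge0 powR_ge0.
Qed.

Lemma sum_int_le_zeta (t : seq int) : uniq t ->
  \sum_(m <- t | m != 0) (`|m%:~R| `^ s)^-1 <= 2 * zeta s.
Proof.
move=> ut; rewrite (bigID (fun m : int => 0 < m))/= mulr_natl mulr2n.
have half (u : seq int) (Q : pred int) : uniq u ->
    {in Q &, injective (fun m : int => `|m|%N)} -> (forall m, Q m -> m != 0) ->
    \sum_(m <- u | Q m) (`|m%:~R| `^ s)^-1 <= zeta s.
  move=> uu Qi Q0.
  have -> : \sum_(m <- u | Q m) (`|m%:~R| `^ s)^-1 =
      \sum_(n <- [seq `|m|%N.-1 | m <- u & Q m]) riemannR s n.
    rewrite big_map big_filter; apply: eq_bigr => m /Q0 m0 /=.
    rewrite /riemannR prednK ?absz_gt0//; congr (_ `^ _)^-1.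
    by rewrite -intr_norm -abszE.
  apply: sum_riemannR_le_zeta; rewrite map_inj_in_uniq ?filter_uniq//.
  move=> a b; rewrite !mem_filter => /andP[Qa _] /andP[Qb _] ab.
  apply: Qi => //; have := Q0 _ Qa; have := Q0 _ Qb; move: ab; lia.
apply: lerD; apply: half => //.
- by move=> a b /andP[_ a0] /andP[_ b0]; lia.
- by move=> m /andP[].
- by move=> a b /andP[_ a0] /andP[_ b0]; lia.
- by move=> m /andP[].
Qed.

End zeta_bounds.

(** * Counting generating vectors and draws *)

Section sums_over_tuples.
Variables (A : comPzSemiRingType) (T : finType) (r : nat).

Lemma sum_tuple_prod (F : 'I_r -> T -> A) :
  \sum_(t : r.-tuple T) \prod_(i < r) F i (tnth t i) = \prod_(i < r) \sum_(x : T) F i x.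
Proof.
rewrite bigA_distr_bigA/=.
rewrite (reindex (fun f : {ffun 'I_r -> T} => [tuple f i | i < r])); last first.
  exists (fun t => [ffun i => tnth t i]) => x _.
    by apply/ffunP => i; rewrite ffunE tnth_mktuple.
  by apply: eq_from_tnth => i; rewrite tnth_mktuple ffunE.
by apply: eq_bigr => f _; apply: eq_bigr => i _; rewrite tnth_mktuple.
Qed.

End sums_over_tuples.

Lemma card_tuple_family (T : finType) (r : nat) (X : 'I_r -> {set T}) :
  #|[set t : r.-tuple T | [forall i, tnth t i \in X i]]%SET| = (\prod_(i < r) #|X i|)%N.
Proof.
rewrite -sum1dep_card big_mkcond/=.
under [RHS]eq_bigr => i _ do rewrite -sum1_card big_mkcond.
rewrite -(@sum_tuple_prod nat); apply: eq_bigr => t _.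
case: ifP => [/forallP h|/negbT].
  by rewrite big1// => i _; rewrite h.
rewrite negb_forall => /existsP[i it].
by rewrite (bigD1 i)//= (negbTE it) mul0r.
Qed.

Section draws_counting.
Variables (d r N : nat).
Local Notation G := (gen_vectors d N).
Local Notation D := (draws d r N).

Lemma card_draws : #|D| = (#|G| ^ r)%N.
Proof.
by rewrite /draws (card_tuple_family (fun=> G)) prod_nat_const card_ord.
Qed.

Lemma card_draws_all (B : {set d.-tuple 'I_N}) : B \subset G ->
  #|[set zs in D | [forall i, tnth zs i \in B]]%SET| = (#|B| ^ r)%N.
Proof.
move=> BG; rewrite -[in RHS](card_ord r) -prod_nat_const -card_tuple_family.
apply: eq_card => zs; rewrite !inE andb_idl// => /forallP h.
by apply/forallP => i; apply: (fintype.subsetP BG).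
Qed.

(** One draw is uniform on the generating vectors; stated without division. *)
Lemma card_draws_one (B : {set d.-tuple 'I_N}) (i : 'I_r) : B \subset G ->
  (#|[set zs in D | tnth zs i \in B]%SET| * #|G| = #|B| * #|D|)%N.
Proof.
move=> BG; pose X j := if j == i then B else G.
have -> : #|[set zs in D | tnth zs i \in B]%SET| = (\prod_(j < r) #|X j|)%N.
  rewrite -card_tuple_family; apply: eq_card => zs; rewrite !inE.
  apply/andP/forallP => [[/forallP h hB] j|h].
    by rewrite /X; case: eqP => [->|].
  split; last by have := h i; rewrite /X eqxx.
  apply/forallP => j; have := h j; rewrite /X; case: eqP => // _.
  exact: (fintype.subsetP BG).
rewrite (bigD1 i)//= /X eqxx -mulnA; congr (_ * _)%N.
rewrite (eq_bigr (fun=> #|G|)); last by move=> j /negbTE ->.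
by rewrite card_draws -[in RHS](card_ord r) -prod_nat_const [RHS](bigD1 i)//= mulnC.
Qed.

Definition set_component (z : d.-tuple 'I_N) (j : 'I_d) (s : 'I_N) : d.-tuple 'I_N :=
  [tuple if i == j then s else tnth z i | i < d].

(** For each value of the other components at most one value of the [j]-th one
    solves k.z = 0 mod N, so that the map replacing this component by an
    arbitrary nonzero residue is injective on the dual vectors. *)
Lemma card_dual (k : d.-tuple int) (j : 'I_d) : prime N -> ~~ (N %| tnth k j)%Z ->
  (#|[set z in G | dual z k]%SET| * N.-1 <= #|G|)%N.
Proof.
move=> pN Nk.
have Npos := prime_gt0 pN.
have -> : N.-1 = #|[set s : 'I_N | (0 < val s)%N]%SET|.
  rewrite -sum1dep_card big_mkcond/= -(big_mkord xpredT (fun i => if (0 < i)%N then 1%N else 0%N)).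
  by rewrite big_ltn// add0n big_nat_cond (eq_bigr (fun=> 1%N)) => [|[|]//];
    rewrite -big_nat_cond sum_nat_const_nat muln1 subn1.
rewrite -cardsX -(card_in_imset (f := fun p => set_component p.1 j p.2)).
  apply: subset_leq_card; apply/fintype.subsetP => _ /imsetP[[z s] /= + ->].
  rewrite !inE/= => /andP[/andP[/forallP zG _] s0].
  by apply/forallP => i; rewrite tnth_mktuple; case: eqP.
move=> [z s] [z' s']; rewrite !inE/= => /andP[/andP[zG zk] s0] /andP[/andP[z'G z'k] s'0].
move=> e; have et i := congr1 (fun t => tnth t i) e.
have ss : s = s' by have := et j; rewrite !tnth_mktuple eqxx.
have zi i : i != j -> tnth z i = tnth z' i.
  by move=> /negbTE ij; have := et i; rewrite !tnth_mktuple ij.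
suff zj : tnth z j = tnth z' j.
  congr (_, _) => //; apply: eq_from_tnth => i.
  by have [->//|] := eqVneq i j; exact: zi.
have : (N %| dotz k z - dotz k z')%Z by exact: (rpredB zk z'k).
rewrite /dotz (bigD1 j)//= [X in _ - X](bigD1 j)//=.
rewrite (eq_bigr (fun i => tnth k i * (tnth z' i : nat)%:Z)); last by move=> i /zi ->.
rewrite opprD addrACA subrr addr0 -mulrBr.
rewrite Gauss_dvdzr; last by rewrite coprimezE prime_coprime.
rewrite -eqz_mod_dvd !modz_nat !modn_small// => /eqP[zz].
exact: val_inj.
Qed.

End draws_counting.

(** * Sums of weights over dual lattices *)

Section weight_sums.
Variables (R : realType) (d : nat) (alpha : R) (gamma : nat -> R) (lambda : R).
Hypothesis gamma01 : forall j, 0 <= gamma j <= 1.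
Hypothesis lambda0 : 0 < lambda.
Hypothesis lambda_alpha : lambda < alpha.
Implicit Types (k : d.-tuple int).
Local Notation freq0 := (freq0 d).
Local Notation wt := (@weight R d alpha gamma).
Local Notation wt1 := (weight1 alpha gamma).
Local Notation V := (korobov_prod d alpha gamma lambda).

Let alpha0 : 0 < alpha. Proof. exact: lt_trans lambda_alpha. Qed.
Let ratio1 : 1 < alpha / lambda. Proof. by rewrite ltr_pdivlMr// mul1r. Qed.

Lemma powR_prod (I : Type) (s : seq I) (F : I -> R) (a : R) :
  (forall i, 0 <= F i) -> (\prod_(i <- s) F i) `^ a = \prod_(i <- s) F i `^ a.
Proof.
move=> F0; elim: s => [|i s IH]; first by rewrite !big_nil powR1.
by rewrite !big_cons powRM ?IH// prodr_ge0.
Qed.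

Lemma sum_weight1_le j (t : seq int) : uniq t ->
  \sum_(m <- t) wt1 j m `^ lambda^-1 <=
  1 + 2 * gamma j `^ lambda^-1 * zeta (alpha / lambda).
Proof.
move=> ut; rewrite (bigID (fun m : int => m == 0))/=; apply: lerD.
  rewrite (eq_bigr (fun=> 1)); last by move=> m /eqP->; rewrite /weight1 powR1.
  by rewrite big_const_seq iter_addr addr0 count_uniq_mem// ; case: (0 \in t).
have g0 : 0 <= gamma j by have /andP[] := gamma01 j.
rewrite (eq_bigr (fun m : int => gamma j `^ lambda^-1 * (`|m%:~R| `^ (alpha / lambda))^-1)).
  rewrite -mulr_sumr [2 * _]mulrC -mulrA ler_wpM2l ?powR_ge0//.
  exact: sum_int_le_zeta.
move=> m /negbTE m0; rewrite /weight1 m0 powRM ?invr_ge0 ?powR_ge0//.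
congr (_ * _); rewrite -powRN -powRrM -powRN; congr (_ `^ _); ring.
Qed.

(** A finite set of frequencies lies in a product of finite sets of integers,
    over which the sum of the product weights factorizes. *)
Lemma sum_weight_le (s : seq (d.-tuple int)) : uniq s ->
  \sum_(k <- s) wt k `^ lambda^-1 <= V.
Proof.
move=> us.
pose cs := undup (flatten [seq tval k | k <- s]).
pose T : finType := seq_sub cs.
pose tot (t : d.-tuple T) : d.-tuple int := [tuple val (tnth t j) | j < d].
apply: (@le_trans _ _ (\sum_(k <- [seq tot t | t <- enum {: d.-tuple T}]) wt k `^ lambda^-1)).
  apply: ler_sum_subseq => //; last by move=> k; exact: powR_ge0.
  move=> k ks; have kc j : tnth k j \in cs.
    rewrite mem_undup; apply/flattenP; exists (tval k); last exact: mem_tnth.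
    exact: map_f.
  apply/mapP; exists [tuple SeqSub (kc j) | j < d]; first by rewrite mem_enum.
  by apply: eq_from_tnth => j; rewrite !tnth_mktuple.
rewrite big_map big_enum/=.
under eq_bigr => t _.
  rewrite /weight powR_prod; last by move=> j; exact: weight1_ge0.
  under eq_bigr do rewrite tnth_mktuple.
  over.
rewrite (sum_tuple_prod (fun (j : 'I_d) (x : T) => wt1 j (val x) `^ lambda^-1)).
apply: ler_prod => j _; rewrite sumr_ge0//=; last by move=> x _; exact: powR_ge0.
have -> : \sum_(x : T) wt1 j (val x) `^ lambda^-1 =
    \sum_(m <- [seq val x | x <- enum T]) wt1 j m `^ lambda^-1.
  by rewrite big_map big_enum.
by apply: sum_weight1_le; rewrite map_inj_uniq ?enum_uniq//; exact: val_inj.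
Qed.

Lemma korobov_prod_ge1 : 1 <= V.
Proof.
have := @sum_weight_le [:: freq0] isT; rewrite big_seq1.
have -> : wt freq0 = 1.
  by rewrite /weight big1// => j _; rewrite tnth_mktuple /weight1 eqxx.
by rewrite powR1.
Qed.

Section divisible_frequencies.
Variable N : nat.
Hypothesis N0 : (0 < N)%N.

Definition freq_divisible k : bool := [forall j, (N %| tnth k j)%Z].
Definition freq_quot k : d.-tuple int := [tuple (tnth k j %/ N)%Z | j < d].

Lemma freq_divisibleE k j : freq_divisible k -> tnth k j = tnth (freq_quot k) j * N.
Proof. by move=> /forallP/(_ j) /divzK; rewrite tnth_mktuple. Qed.

(** Some component is nonzero and gains the factor N^(alpha/lambda) >= N. *)
Lemma weight_freq_divisible k : freq_divisible k -> k != freq0 ->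
  wt k `^ lambda^-1 <= wt (freq_quot k) `^ lambda^-1 / N%:R.
Proof.
move=> kN k0.
have Na : 1 <= N%:R `^ alpha :> R.
  apply: (@le_trans _ _ (1 `^ alpha)); first by rewrite powR1.
  by rewrite ge0_ler_powR ?nnegrE ?ler1n// ltW.
have Np : 0 < N%:R `^ alpha :> R by apply: lt_le_trans Na.
have w1 (m : int) j : m != 0 -> wt1 j (m * N) = wt1 j m / N%:R `^ alpha.
  move=> m0; have mN : (m * N == 0) = false by apply/negbTE; nia.
  rewrite /weight1 (negbTE m0) mN.
  rewrite intrM normrM powRM// invfM mulrA.
  by congr (_ / _ `^ _); exact: normr_nat.
have w1le (m : int) j : wt1 j (m * N) <= wt1 j m.
  have [->|m0] := eqVneq m 0; first by rewrite mul0r.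
  by rewrite w1// ler_pdivrMr// ler_peMr// weight1_ge0.
have [j kj] : exists j, tnth k j != 0.
  by move: k0; rewrite eq_freq0 negb_forall => /existsP.
have wk : wt k <= wt (freq_quot k) / N%:R `^ alpha.
  rewrite /weight (bigD1 j)//= [X in _ <= X / _](bigD1 j)//= mulrAC.
  have qj : tnth (freq_quot k) j != 0.
    by apply: contraNneq kj => q0; rewrite (freq_divisibleE j kN) q0 mul0r.
  rewrite (freq_divisibleE j kN) w1// ler_wpM2l ?divr_ge0 ?weight1_ge0 ?powR_ge0//.
  by apply: ler_prod => i _; rewrite weight1_ge0//= (freq_divisibleE i kN) w1le.
apply: (@le_trans _ _ ((wt (freq_quot k) / N%:R `^ alpha) `^ lambda^-1)).
  by rewrite ge0_ler_powR ?nnegrE ?weight_ge0 ?invr_ge0 ?(ltW lambda0)//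
    divr_ge0 ?weight_ge0 ?powR_ge0.
rewrite powRM ?weight_ge0 ?invr_ge0 ?powR_ge0//.
rewrite ler_wpM2l ?powR_ge0// -powRN -powRrM mulNr powRN.
rewrite lef_pV2 ?posrE ?powR_gt0 ?ltr0n//.
rewrite -[leLHS](powRr1 (ler0n _ _)) ler_powR ?ler1n//.
exact: ltW.
Qed.

(** Division by N maps the multiples of N injectively into all frequencies. *)
Lemma sum_weight_freq_divisible_le (s : seq (d.-tuple int)) : uniq s ->
  all (fun k => k != freq0) s ->
  \sum_(k <- s | freq_divisible k) wt k `^ lambda^-1 <= V / N%:R.
Proof.
move=> us s0.
apply: (@le_trans _ _ (\sum_(k <- s | freq_divisible k) wt (freq_quot k) `^ lambda^-1 / N%:R)).
  rewrite big_seq_cond [leRHS]big_seq_cond; apply: ler_sum => k /andP[ks kN].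
  by apply: weight_freq_divisible => //; exact: (allP s0).
rewrite -mulr_suml ler_wpM2r ?invr_ge0//.
rewrite -big_filter -(big_map freq_quot xpredT (fun k => wt k `^ lambda^-1)).
apply: sum_weight_le; rewrite map_inj_in_uniq ?filter_uniq// => k l.
rewrite !mem_filter => /andP[kN _] /andP[lN _] e.
by apply: eq_from_tnth => j; rewrite (freq_divisibleE j kN) (freq_divisibleE j lN) e.
Qed.

End divisible_frequencies.

(** Exchanging the sums, a multiple of N is dual to every vector and any other
    frequency to a proportion at most 1 / (N - 1) of them; both parts are at
    most V / (N - 1). *)
Lemma sum_dual_weight_le N (s : seq (d.-tuple int)) : prime N -> uniq s ->
  all (fun k => k != freq0) s ->
  \sum_(z in gen_vectors d N) \sum_(k <- s | dual z k) wt k `^ lambda^-1 <=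
  #|gen_vectors d N|%:R * (2 * V / N.-1%:R).
Proof.
move=> pN us s0; have N0 := prime_gt0 pN.
set G := gen_vectors d N.
have N1 : 0 < N.-1%:R :> R by rewrite ltr0n; have := prime_gt1 pN; lia.
have V0 : 0 <= V by apply: le_trans korobov_prod_ge1.
rewrite (exchange_big_dep xpredT)//=.
rewrite (eq_bigr (fun k => #|[set z in G | dual z k]%SET|%:R * wt k `^ lambda^-1)); last first.
  move=> k _; rewrite mulr_natl -sumr_const; apply: eq_bigl => z.
  by rewrite inE.
rewrite (bigID (@freq_divisible N))/=.
have h1 : \sum_(k <- s | freq_divisible N k) #|[set z in G | dual z k]%SET|%:R * wt k `^ lambda^-1
    <= #|G|%:R * (V / N.-1%:R).
  apply: (@le_trans _ _ (\sum_(k <- s | freq_divisible N k) #|G|%:R * wt k `^ lambda^-1)).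
    apply: ler_sum => k _; rewrite ler_wpM2r ?powR_ge0// ler_nat.
    by apply: subset_leq_card; apply/fintype.subsetP => z; rewrite inE => /andP[].
  rewrite -mulr_sumr ler_wpM2l//; apply: le_trans (sum_weight_freq_divisible_le N0 us s0) _.
  have NR : 0 < N%:R :> R by rewrite ltr0n.
  rewrite ler_wpM2l//; have -> : (N%:R^-1 <= N.-1%:R^-1 :> R) = (N.-1%:R <= N%:R :> R).
    by rewrite lef_pV2.
  by rewrite ler_nat leq_pred.
have h2 : \sum_(k <- s | ~~ freq_divisible N k)
    #|[set z in G | dual z k]%SET|%:R * wt k `^ lambda^-1
    <= #|G|%:R * (V / N.-1%:R).
  apply: (@le_trans _ _ (\sum_(k <- s | ~~ freq_divisible N k)
      (#|G|%:R / N.-1%:R) * wt k `^ lambda^-1)).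
    apply: ler_sum => k; rewrite negb_forall => /existsP[j kj].
    rewrite ler_wpM2r ?powR_ge0// ler_pdivlMr// -natrM ler_nat.
    exact: card_dual kj.
  rewrite -mulr_sumr -mulrA ler_wpM2l// mulrC ler_wpM2r ?invr_ge0 ?(ltW N1)//.
  apply: le_trans (sum_weight_le us).
  rewrite [leRHS](bigID (@freq_divisible N))/= lerDr.
  by apply: sumr_ge0 => k _; exact: powR_ge0.
apply: le_trans (lerD h1 h2) _.
by rewrite le_eqVlt; apply/orP; left; apply/eqP; ring.
Qed.

End weight_sums.

(** * Good generating vectors and prime divisors of a frequency *)

Section good_vectors.
Variables (R : realType) (d : nat) (alpha : R) (gamma : nat -> R) (lambda : R).
Hypothesis gamma01 : forall j, 0 <= gamma j <= 1.
Hypothesis lambda0 : 0 < lambda.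
Hypothesis lambda_alpha : lambda < alpha.
Variable N : nat.
Hypothesis pN : prime N.
Local Notation freq0 := (freq0 d).
Local Notation wt := (@weight R d alpha gamma).
Local Notation V := (korobov_prod d alpha gamma lambda).
Local Notation G := (gen_vectors d N).

(** The sum of w(k)^(1/lambda) over the dual lattice without 0 is at most [T].
    Finite subsums avoid infinite values. *)
Definition good_vector (T : R) (z : d.-tuple 'I_N) : bool :=
  `[< forall s, uniq s -> all (fun k => (k != freq0) && dual z k) s ->
      \sum_(k <- s) wt k `^ lambda^-1 <= T >].

(** Markov's inequality.  Each bad vector has a finite set of frequencies that
    witnesses it, and the finite union of these sets is used for all vectors. *)
Lemma card_bad_le (T : R) : 0 < T ->
  #|[set z in G | ~~ good_vector T z]%SET|%:R * T <= #|G|%:R * (2 * V / N.-1%:R).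
Proof.
move=> T0; set Bd := [set _ in _ | _]%SET.
have wit z : exists s : seq (d.-tuple int), z \in Bd ->
    [/\ uniq s, all (fun k => (k != freq0) && dual z k) s &
      T < \sum_(k <- s) wt k `^ lambda^-1].
  have [zB|_] := boolP (z \in Bd); last by exists [::].
  move: zB; rewrite inE => /andP[_ /asboolPn /existsNP[s]].
  by move=> /not_implyP[us /not_implyP[zs /negP]]; rewrite -ltNge => lt; exists s.
have [F FP] := choice wit.
pose A := undup (flatten [seq F z | z <- enum Bd]).
have A0 : all (fun k => k != freq0) A.
  apply/allP => k; rewrite mem_undup => /flattenP[_ /mapP[z + ->]].
  by rewrite mem_enum => /FP[_ /allP h _] /h /andP[].
apply: le_trans (sum_dual_weight_le gamma01 lambda0 lambda_alpha pN (undup_uniq _) A0).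
apply: (@le_trans _ _ (\sum_(z in Bd) \sum_(k <- A | dual z k) wt k `^ lambda^-1)).
  rewrite mulr_natl -sumr_const; apply: ler_sum => z zB.
  have [us zs /ltW Tle] := FP z zB; apply: le_trans Tle _.
  rewrite -[leRHS]big_filter; apply: ler_sum_subseq => // [k ks|k]; last exact: powR_ge0.
  have /andP[_ kz] := allP zs k ks; rewrite mem_filter kz mem_undup.
  by apply/flattenP; exists (F z) => //; apply: map_f; rewrite mem_enum.
rewrite [leRHS](bigID (mem Bd))/= [X in _ <= X + _](eq_bigl (mem Bd)); last first.
  by move=> z; rewrite !inE andbA andbb.
rewrite lerDl; apply: sumr_ge0 => z _; apply: sumr_ge0 => k _; exact: powR_ge0.
Qed.

End good_vectors.

Lemma primes_inP M N : N \in primes_in M -> [/\ prime N, (uphalf M < N)%N & (N <= M)%N].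
Proof. by rewrite mem_filter => /andP[/and3P[]]. Qed.

Section prime_divisors.
Variable R : realType.

(** The primes of the range are at least the square root of M, and distinct
    primes dividing K have a product dividing K. *)
Lemma count_prime_divisors M K : (0 < K)%N ->
  (M ^ count (fun N => (N %| K)%N) (primes_in M) <= K ^ 2)%N.
Proof.
move=> K0; set s := [seq N <- primes_in M | (N %| K)%N].
have -> : count (fun N => (N %| K)%N) (primes_in M) = size s by rewrite size_filter.
have sP p : p \in s -> [/\ prime p, (M <= p ^ 2)%N & (p %| K)%N].
  rewrite mem_filter => /andP[pK /primes_inP[pp up _]]; split => //.
  by have := prime_gt1 pp; have := uphalf_half M; have := odd_double_half M; nia.
have dv : (\prod_(p <- s) p %| K)%N.
  apply: dvdn_prod_primes; first by rewrite !filter_uniq// iota_uniq.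
  - by apply/allP => p /sP[].
  - by move=> p /sP[].
have : (\prod_(p <- s) p <= K)%N by exact: dvdn_leq.
rewrite -(leq_exp2r _ _ (isT : (0 < 2)%N)); apply: leq_trans.
have : all (fun p => (M <= p ^ 2)%N) s by apply/allP => p /sP[].
elim: s {sP dv} => [|p s IH] /=; first by rewrite big_nil.
by move=> /andP[Mp /IH h]; rewrite big_cons expnMn expnS leq_mul.
Qed.

(** Apply ln y <= y - 1 to y = x^a. *)
Lemma ln_le_powR (x a : R) : 0 < x -> 0 < a -> ln x <= x `^ a / a.
Proof.
move=> x0 a0; rewrite ler_pdivlMr// mulrC -ln_powR.
have xa : 0 < x `^ a by rewrite powR_gt0.
have := @le_ln1Dx R (x `^ a - 1); rewrite (_ : 1 + (x `^ a - 1) = x `^ a); last by ring.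
by move=> /(_ ltac:(lra)); lra.
Qed.

Variables (d : nat) (alpha : R) (gamma : nat -> R) (delta c : R).
Hypothesis gamma01 : forall j, 0 <= gamma j <= 1.
Hypothesis alpha0 : 0 < alpha.
Hypothesis delta0 : 0 < delta.
Hypothesis alpha_delta : alpha * delta <= 1.
Hypothesis c0 : 0 < c.
Variable M : nat.
Hypothesis M2 : (2 <= M)%N.
Hypothesis chebyshev_c : primes_in M != [::] ->
    c * M%:R <= (size (primes_in M))%:R * ln (M%:R : R).
Local Notation wt := (@weight R d alpha gamma).

(** The proportion of the primes dividing [k] grows only like ln |k_j|, and
    w(k)^delta is at most |k_j|^(- alpha delta); the quotient is controlled by
    [ln_le_powR].  The term 2 / M is harmless because alpha delta <= 1. *)
Lemma weight_prime_density k : k != freq0 d ->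
  wt k `^ delta * (2 / M%:R +
    (size (primes_in M))%:R^-1 * (count (fun N => freq_divisible N k) (primes_in M))%:R)
  <= 2 * (1 + c^-1) / (alpha * delta * M%:R).
Proof.
rewrite eq_freq0 negb_forall => /existsP[j kj].
have M0 : 0 < M%:R :> R by rewrite ltr0n; lia.
have ad0 : 0 < alpha * delta by rewrite mulr_gt0.
have w0 := weight_ge0 alpha gamma01 k.
have w1 := weight_le1 alpha0 gamma01 k.
have wd1 : wt k `^ delta <= 1.
  apply: (@le_trans _ _ (1 `^ delta)); last by rewrite powR1.
  by rewrite ge0_ler_powR ?nnegrE// ltW.
have -> : 2 * (1 + c^-1) / (alpha * delta * M%:R) =
  1 * (2 / M%:R / (alpha * delta)) + 2 / (c * (alpha * delta) * M%:R).
  by field; rewrite !gt_eqF.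
rewrite mulrDr; apply: lerD.
  apply: ler_pM => //; [exact: powR_ge0|].
  by rewrite ler_peMr ?divr_ge0 ?(ltW M0)// invf_ge1.
set m := count _ _; set P := size _.
have [P0|P0] := eqVneq (primes_in M) [::].
  rewrite /P P0 invr0 mul0r mulr0 divr_ge0//.
  by rewrite !mulr_ge0// ltW.
have cheb := chebyshev_c P0.
pose K := `|tnth k j|%N.
have K0 : (0 < K)%N by rewrite absz_gt0.
have KR : 1 <= K%:R :> R by rewrite ler1n.
have Kp : 0 < K%:R :> R by lra.
have mK : (m <= count (fun N => (N %| K)%N) (primes_in M))%N.
  by apply: sub_count => N /forallP/(_ j).
have lnM0 : 0 < ln M%:R :> R by rewrite ln_gt0// ltr1n.
have P0R : 0 < P%:R :> R by rewrite ltr0n lt0n size_eq0.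
have mln : m%:R * ln M%:R <= 2 * ln K%:R :> R.
  rewrite !mulr_natl -!lnXn//; rewrite ler_ln ?posrE ?exprn_gt0// -!natrX ler_nat.
  apply: leq_trans (count_prime_divisors M K0); rewrite leq_exp2l//.
have mP : P%:R^-1 * m%:R <= 2 * ln K%:R / (c * M%:R).
  rewrite ler_pdivlMr ?mulr_gt0//; apply: le_trans mln.
  rewrite -mulrA mulrCA ler_wpM2l// ler_pdivrMl// mulrC.
have wK : wt k `^ delta <= (K%:R `^ (alpha * delta))^-1.
  have -> : (K%:R `^ (alpha * delta))^-1 = ((K%:R `^ alpha)^-1) `^ delta.
    by rewrite -[in RHS]powRN -powRrM mulNr powRN.
  rewrite ge0_ler_powR ?nnegrE ?invr_ge0 ?powR_ge0 ?(ltW delta0)//.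
  have -> : K%:R = `|(tnth k j)%:~R| :> R by rewrite -intr_norm -abszE.
  exact: weight_le.
apply: (@le_trans _ _ ((K%:R `^ (alpha * delta))^-1 *
  (2 * (K%:R `^ (alpha * delta) / (alpha * delta)) / (c * M%:R)))).
  apply: ler_pM => //; [exact: powR_ge0|].
  apply: le_trans mP _; rewrite ler_wpM2r ?invr_ge0 ?mulr_ge0 ?(ltW M0) ?(ltW c0)//.
  by rewrite ler_wpM2l// ln_le_powR.
have Ka : 0 < K%:R `^ (alpha * delta) :> R by rewrite powR_gt0.
rewrite le_eqVlt; apply/orP; left; apply/eqP; field.
by rewrite !gt_eqF.
Qed.

End prime_divisors.

(** * Averaging over the prime and the draws *)

Lemma mean_le (R : realType) (T : eqType) (s : seq T) (F : T -> \bar R) (g : T -> R) :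
  (forall x, x \in s -> (F x <= (g x)%:E)%E) ->
  (mean s F <= ((size s)%:R^-1 * \sum_(x <- s) g x)%:E)%E.
Proof.
move=> Fg; rewrite /mean EFinM lee_wpmul2l// ?lee_fin ?invr_ge0//.
by rewrite -sumEFin big_seq [leRHS]big_seq; apply: lee_sum.
Qed.

(** A division by zero counts as zero, so an average over an empty family
    needs no separate treatment. *)
Lemma ler_average (R : realFieldType) (n : nat) (x b : R) :
  0 <= b -> x <= b * n%:R -> n%:R^-1 * x <= b.
Proof.
move=> b0; have [->|n0] := posnP n; first by rewrite invr0 mul0r.
by move=> xb; rewrite ler_pdivrMl ?ltr0n// mulrC.
Qed.

Lemma pred_prime_ge (R : realFieldType) M N : N \in primes_in M -> (0 < M)%N ->
  (0 : R) < N.-1%:R /\ N.-1%:R^-1 <= 2 / M%:R :> R.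
Proof.
move=> /primes_inP[pN uN _] M0; have N1 := prime_gt1 pN.
have N0 : (0 : R) < N.-1%:R by rewrite ltr0n -subn1 subn_gt0.
have MN : (M <= 2 * N.-1)%N.
  by move: uN; rewrite uphalf_half; have := odd_double_half M; lia.
have MR : (0 : R) < M%:R by rewrite ltr0n.
split => //; rewrite ler_pdivlMr// mulrC ler_pdivrMr// -natrM ler_nat.
exact: MN.
Qed.

Lemma sum_indicator (R : pzSemiRingType) (T : finType) (A : {set T}) (Q : pred T) :
  \sum_(x in A) (Q x)%:R = #|[set x in A | Q x]%SET|%:R :> R.
Proof.
rewrite -sum1dep_card natr_sum big_mkcondr/=.
by apply: eq_bigr => x _; case: (Q x).
Qed.

Section randomized_error.
Variables (R : realType) (d r M : nat) (alpha : R) (gamma : nat -> R).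
Variables (eta lambda delta c : R).
Variable sel : forall N, r.-tuple (d.-tuple 'I_N) -> 'I_r.
Hypothesis gamma01 : forall j, 0 <= gamma j <= 1.
Hypothesis M2 : (2 <= M)%N.
Hypothesis eta01 : 0 < eta < 1.
Hypothesis selP : selects_best M alpha gamma sel.
Hypothesis lambda2 : 2^-1 <= lambda.
Hypothesis lambda_alpha : lambda < alpha.
Hypothesis delta0 : 0 < delta.
Hypothesis alpha_delta : alpha * delta <= 1.
Hypothesis c0 : 0 < c.
Hypothesis chebyshev_c : primes_in M != [::] ->
    c * M%:R <= (size (primes_in M))%:R * ln (M%:R : R).
Implicit Types (k : d.-tuple int).
Local Notation freq0 := (freq0 d).
Local Notation wt := (@weight R d alpha gamma).
Local Notation V := (korobov_prod d alpha gamma lambda).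
Local Notation G := (gen_vectors d).
Local Notation D := (draws d r).

Let lambda0 : 0 < lambda.
Proof. by apply: lt_le_trans lambda2; rewrite invr_gt0. Qed.
Let alpha0 : 0 < alpha. Proof. exact: lt_trans lambda_alpha. Qed.
Let eta1 : 0 < 1 - eta. Proof. by have /andP[_] := eta01; rewrite subr_gt0. Qed.
Let M0 : 0 < M%:R :> R. Proof. by rewrite ltr0n; apply: leq_trans M2. Qed.
Let V0 : 0 < V.
Proof. exact: lt_le_trans (korobov_prod_ge1 d gamma01 lambda0 lambda_alpha). Qed.

(** Since N - 1 >= M / 2, Markov's inequality with this threshold leaves a
    proportion at most 1 - eta of bad vectors. *)
Let T : R := 4 * V / ((1 - eta) * M%:R).
Let B : R := T `^ lambda.
Let T0 : 0 < T. Proof. by rewrite divr_gt0 ?mulr_gt0. Qed.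
Let B0 : 0 < B. Proof. exact: powR_gt0. Qed.

Definition bad_vectors N : {set d.-tuple 'I_N} :=
  [set z in G N | ~~ good_vector alpha gamma lambda T z]%SET.

Lemma card_bad_vectors N : N \in primes_in M ->
  #|bad_vectors N|%:R <= (1 - eta) * #|G N|%:R.
Proof.
move=> NM; have [pN _ _] := primes_inP NM.
have [N1 Ninv] := pred_prime_ge R NM (leq_trans (isT : (0 < 2)%N) M2).
rewrite -(ler_pM2r T0); apply: le_trans (card_bad_le d gamma01 lambda0 lambda_alpha pN T0) _.
rewrite [leRHS](_ : _ = #|G N|%:R * ((1 - eta) * T)); last by ring.
rewrite ler_wpM2l//.
have -> : (1 - eta) * T = 2 * V * (2 / M%:R) by rewrite /T; field; rewrite !gt_eqF.
by rewrite ler_wpM2l// mulr_ge0// ltW.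
Qed.

Lemma card_dual_density N k : N \in primes_in M ->
  #|[set z in G N | dual z k]%SET|%:R <= ((freq_divisible N k)%:R + 2 / M%:R) * #|G N|%:R :> R.
Proof.
move=> NM; have [pN _ _] := primes_inP NM.
have [N1 Ninv] := pred_prime_ge R NM (leq_trans (isT : (0 < 2)%N) M2).
have [kN|] := boolP (freq_divisible N k).
  apply: (@le_trans _ _ #|G N|%:R).
    by rewrite ler_nat; apply: subset_leq_card; apply/fintype.subsetP => z; rewrite inE => /andP[].
  by rewrite ler_peMl// lerDl divr_ge0// ltW.
rewrite negb_forall => /existsP[j kj]; rewrite add0r.
apply: (@le_trans _ _ (N.-1%:R^-1 * #|G N|%:R)); last by rewrite ler_wpM2r.
by rewrite ler_pdivlMl// mulrC -natrM ler_nat; exact: card_dual kj.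
Qed.

Lemma card_gen_vectors_gt0 N : N \in primes_in M -> (0 < #|G N|)%N.
Proof.
move=> /primes_inP[/prime_gt1 N1 _ _]; apply/card_gt0P.
exists [tuple Ordinal N1 | j < d]; rewrite inE; apply/forallP => j.
by rewrite tnth_mktuple.
Qed.

(** The only use of the selection rule: the retained vector has at most the worst-case error of
    a good draw, which is at most B, and this error is at least w(k). *)
Lemma weight_le_of_dual N (zs : r.-tuple (d.-tuple 'I_N)) k :
  N \in primes_in M -> zs \in D N ->
  ~~ [forall i, tnth zs i \in bad_vectors N] ->
  k != freq0 -> dual (tnth zs (sel zs)) k -> 0 < wt k -> wt k <= B.
Proof.
move=> NM zsD; rewrite negb_forall => /existsP[i ib] k0 kz w0.
have [pN _ _] := primes_inP NM; have N0 := prime_gt0 pN.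
have zG : tnth zs i \in G N by move: zsD; rewrite inE => /forallP.
have gi : good_vector alpha gamma lambda T (tnth zs i).
  by move: ib; rewrite inE zG/= negbK.
rewrite -lee_fin; apply: (le_trans (weight_le_ewor (alpha := alpha) gamma01 N0 k0 kz w0)).
apply: (le_trans (selP i NM zsD)).
by apply: ewor_le => //; move: gi => /asboolP.
Qed.

(** The squared modulus of the Fourier coefficient, for the [u] of [unit_ballP]. *)
Let q (u : d.-tuple int -> R) k := wt k ^+ 2 * u k.
Let relevant k := [&& k != freq0, 0 < wt k & wt k <= B].

(** Either all the draws are bad, and the whole sum is at most 1, or only
    frequencies with w(k) <= B occur, each of which is dual to the retained
    vector and hence to at least one of the draws. *)
Lemma dual_energy_le N (zs : r.-tuple (d.-tuple 'I_N)) (u : d.-tuple int -> R)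
    (A : seq (d.-tuple int)) :
  N \in primes_in M -> zs \in D N -> (forall k, 0 <= u k) ->
  \sum_(k <- A) u k <= 1 ->
  \sum_(k <- A | (k != freq0) && dual (tnth zs (sel zs)) k) q u k <=
  [forall i, tnth zs i \in bad_vectors N]%:R +
  \sum_(k <- A | relevant k) \sum_(i < r) (dual (tnth zs i) k)%:R * q u k.
Proof.
move=> NM zsD u0 u1.
have q0 k : 0 <= q u k by rewrite mulr_ge0 ?sqr_ge0.
have s0 k : 0 <= \sum_(i < r) (dual (tnth zs i) k)%:R * q u k.
  by apply: sumr_ge0 => i _; rewrite mulr_ge0.
have [allbad|nbad] := boolP [forall i, tnth zs i \in bad_vectors N].
  apply: (@le_trans _ _ 1); last by rewrite lerDl sumr_ge0.
  apply: le_trans u1; rewrite big_mkcond; apply: ler_sum => k _.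
  case: ifP => // _; rewrite /q ler_piMl// exprn_ile1 ?weight_ge0//.
  exact: (weight_le1 alpha0 gamma01 k).
rewrite add0r big_mkcond [leRHS]big_mkcond; apply: ler_sum => k _.
case: ifPn => [/andP[k0 kz]|_]; last by case: ifP.
have [w0|w0] := eqVneq (wt k) 0.
  by rewrite /q w0 expr0n/= mul0r; case: ifP => // _; exact: sumr_ge0.
have wp : 0 < wt k by rewrite lt_neqAle eq_sym w0 weight_ge0.
rewrite /relevant k0 wp (weight_le_of_dual NM zsD nbad k0 kz wp)/=.
by rewrite (bigD1 (sel zs))//= kz mul1r lerDl sumr_ge0// => i _; rewrite mulr_ge0.
Qed.

(** The union bound over the draws. *)
Lemma average_dual_energy_le N (u : d.-tuple int -> R) (A : seq (d.-tuple int)) (e : R) :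
  N \in primes_in M -> (forall k, 0 <= u k) -> 0 <= e ->
  (size (enum (D N)))%:R^-1 * \sum_(zs <- enum (D N))
    ([forall i, tnth zs i \in bad_vectors N]%:R +
     \sum_(k <- A | relevant k) (\sum_(i < r) (dual (tnth zs i) k)%:R * q u k) + e) <=
  (1 - eta) ^+ r +
  \sum_(k <- A | relevant k) (r%:R * q u k) * ((freq_divisible N k)%:R + 2 / M%:R) + e.
Proof.
move=> NM u0 e0; rewrite -cardE.
have q0 k : 0 <= q u k by rewrite mulr_ge0 ?sqr_ge0.
have rho0 k : 0 <= (freq_divisible N k)%:R + 2 / M%:R :> R by rewrite addr_ge0// divr_ge0// ltW.
apply: ler_average.
  rewrite !addr_ge0 ?exprn_ge0 ?(ltW eta1)// sumr_ge0// => k _.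
  by rewrite mulr_ge0// mulr_ge0.
rewrite !big_split/= [leRHS]mulrDl [X in _ <= X + _]mulrDl.
apply: lerD; first apply: lerD.
- rewrite big_enum/= sum_indicator card_draws_all; last first.
    by apply/fintype.subsetP => z; rewrite inE => /andP[].
  rewrite card_draws !natrX -exprMn lerXn2r ?nnegrE ?mulr_ge0 ?(ltW eta1)//.
  exact: card_bad_vectors.
- rewrite exchange_big/= mulr_suml; apply: ler_sum => k _.
  rewrite exchange_big/=.
  have hi i : \sum_(zs <- enum (D N)) (dual (tnth zs i) k)%:R * q u k <=
      q u k * (((freq_divisible N k)%:R + 2 / M%:R) * #|D N|%:R).
    rewrite -mulr_suml big_enum/= sum_indicator mulrC ler_wpM2l//.
    have G0 : 0 < #|G N|%:R :> R by rewrite ltr0n card_gen_vectors_gt0.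
    pose Bk := [set z in G N | dual z k]%SET.
    have -> : [set zs in D N | dual (tnth zs i) k]%SET =
        [set zs in D N | tnth zs i \in Bk]%SET.
      apply/setP => zs; rewrite [in LHS]inE [in RHS]inE; case: (boolP (zs \in D N)) => //= zsD.
      have zG : tnth zs i \in G N by move: zsD; rewrite inE => /forallP.
      by rewrite inE zG.
    rewrite -(ler_pM2r G0) -natrM card_draws_one; last first.
      by apply/fintype.subsetP => z; rewrite inE => /andP[].
    rewrite natrM mulrAC ler_wpM2r//.
    exact: card_dual_density.
  apply: (@le_trans _ _ (\sum_(i < r) q u k * (((freq_divisible N k)%:R + 2 / M%:R) * #|D N|%:R))).
    by apply: ler_sum => i _; exact: hi.
  by rewrite sumr_const card_ord -[leLHS]mulr_natl !mulrA.
- by rewrite big_const_seq count_predT iter_addr addr0 -cardE mulr_natr.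
Qed.

(** The factor w(k)^2 is split into w(k)^(2 - delta), at most B^(2 - delta), and
    w(k)^delta, which pays for the density of the primes dividing [k]. *)
Lemma average_weight_le (u : d.-tuple int -> R) (A : seq (d.-tuple int)) (e : R) :
  (forall k, 0 <= u k) -> \sum_(k <- A) u k <= 1 -> 0 <= e ->
  (size (primes_in M))%:R^-1 * \sum_(N <- primes_in M)
    ((1 - eta) ^+ r +
     \sum_(k <- A | relevant k) (r%:R * q u k) * ((freq_divisible N k)%:R + 2 / M%:R) + e) <=
  (1 - eta) ^+ r +
  r%:R * (B `^ (2 - delta) * (2 * (1 + c^-1) / (alpha * delta * M%:R))) + e.
Proof.
move=> u0 u1 e0; set X := 2 * (1 + c^-1) / _.
have X0 : 0 <= X.
  by rewrite divr_ge0 ?mulr_ge0 ?addr_ge0 ?invr_ge0 ?(ltW c0) ?(ltW alpha0) ?(ltW delta0).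
set P := size _.
have BX0 : 0 <= B `^ (2 - delta) * X by rewrite mulr_ge0 ?powR_ge0.
rewrite !big_split/= mulrDr [X in X + _ <= _]mulrDr.
apply: lerD; first apply: lerD.
- apply: ler_average; first by rewrite exprn_ge0 ?(ltW eta1).
  by rewrite big_const_seq count_predT iter_addr addr0 mulr_natr.
- rewrite exchange_big/= mulr_sumr.
  apply: (@le_trans _ _ (\sum_(k <- A) r%:R * (B `^ (2 - delta) * X) * u k)); last first.
    by rewrite -mulr_sumr ler_piMr// mulr_ge0.
  rewrite big_mkcond; apply: ler_sum => k _; case: ifP => [|_]; last first.
    by rewrite mulr_ge0// mulr_ge0.
  move=> /and3P[k0 wp wB].
  rewrite -mulr_sumr mulrCA -[leLHS]mulrA -[leRHS]mulrA ler_wpM2l// /q.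
  rewrite mulrAC ler_wpM2r//.
  have [P0|P0] := posnP P; first by rewrite P0 invr0 mul0r mulr0.
  have -> : P%:R^-1 * (\sum_(N <- primes_in M) ((freq_divisible N k)%:R + 2 / M%:R)) =
      2 / M%:R + P%:R^-1 * (count (fun N => freq_divisible N k) (primes_in M))%:R :> R.
    rewrite big_split/= big_const_seq count_predT iter_addr addr0 -/P mulrDr addrC.
    rewrite -[2 / M%:R *+ P]mulr_natl mulKf ?pnatr_eq0 -?lt0n//; congr (_ + _ * _).
    rewrite -sum1_count natr_sum [RHS]big_mkcond.
    by apply: eq_bigr => N _; case: (freq_divisible N k).
  have w2 : wt k ^+ 2 = wt k `^ (2 - delta) * wt k `^ delta.
    rewrite -powRD ?subrK; last by rewrite (gt_eqF wp) implybT.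
    by rewrite powR_mulrn// ltW.
  rewrite w2 -mulrA; apply: ler_pM; first exact: powR_ge0.
  - by rewrite mulr_ge0 ?powR_ge0// addr_ge0 ?divr_ge0 ?(ltW M0).
  - have d2 : 0 <= 2 - delta.
      have a2 : 2^-1 < alpha by exact: le_lt_trans lambda2 lambda_alpha.
      have : 2^-1 * delta <= 1.
        by apply: le_trans alpha_delta; rewrite ler_wpM2r ?ltW.
      by lra.
    by rewrite ge0_ler_powR ?nnegrE ?(ltW wp) ?(ltW B0).
  - exact: weight_prime_density.
- apply: ler_average => //.
  by rewrite big_const_seq count_predT iter_addr addr0 mulr_natr.
Qed.

End randomized_error.

(** * The bound on the root-mean-squared error *)

(** The supremum defining the root-mean-squared error must be nonnegative for
    its square to be monotone, so the unit ball must not be empty. *)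
Lemma zero_unit_ball (R : realType) (d : nat) (alpha : R) (gamma : nat -> R) :
  unit_ball alpha gamma (cst 0 : Rpoint R d -> R).
Proof.
have f0 k : fourier (cst 0 : Rpoint R d -> R) k = 0.
  rewrite /fourier (_ : (fun _ => _) = trigpoly [::] (fun=> 0)); last first.
    by apply/funext => x; rewrite /trigpoly big_nil mul0r.
  by rewrite cintegral_trigpoly big_nil.
have n0 : norm_sqr alpha gamma (cst 0 : Rpoint R d -> R) = 0%E.
  by apply: esum1 => k _; rewrite f0 normc0 expe2 mule0 mul0e.
split; last by rewrite /korobov_norm n0 sqrte0 lee01.
split => //; last by rewrite n0.
split.
  by rewrite /summable esum1// => k _; rewrite f0 normc0 abse0.
move=> x _ U /nbhs_singleton U0; exists fset0 => // A _ /=.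
rewrite partial_sumE big1 ?subr0 ?normc0// => k _.
by rewrite f0 mul0r.
Qed.

Lemma mean_sqr_error_le (R : realType) (d r M : nat) (alpha : R) (gamma : nat -> R)
    (eta lambda delta c : R) (sel : forall N, r.-tuple (d.-tuple 'I_N) -> 'I_r) f :
  (forall j, 0 <= gamma j <= 1) -> (2 <= M)%N ->
  0 < eta < 1 -> selects_best M alpha gamma sel ->
  2^-1 <= lambda -> lambda < alpha -> 0 < delta -> alpha * delta <= 1 -> 0 < c ->
  (primes_in M != [::] -> c * M%:R <= (size (primes_in M))%:R * ln (M%:R : R)) ->
  unit_ball alpha gamma f ->
  (mean_sqr_error M sel f <= ((1 - eta) ^+ r +
    r%:R * (((4 * korobov_prod d alpha gamma lambda / ((1 - eta) * M%:R)) `^ lambda)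
       `^ (2 - delta) * (2 * (1 + c^-1) / (alpha * delta * M%:R))))%:E)%E.
Proof.
move=> gamma01 M2 eta01 selP l2 la d0 ad c0 cheb uf.
have alpha0 : 0 < alpha by apply: lt_trans la; apply: lt_le_trans l2; rewrite invr_gt0.
have [fs [u [u0 uE us]]] := unit_ballP alpha0 gamma01 uf.
apply/lee_addgt0Pr => e e0.
have [A hA] := integral_sqr_error_le fs e0.
have u1 := us A (fset_uniq A).
rewrite -EFinD.
have := average_weight_le r gamma01 M2 eta01 l2 la d0 ad c0 cheb u0 u1 (ltW e0).
rewrite -lee_fin; apply: le_trans.
apply: mean_le => N NM.
have [pN _ _] := primes_inP NM; have N0 := prime_gt0 pN.
have := average_dual_energy_le r gamma01 M2 eta01 l2 la A NM u0 (ltW e0).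
rewrite -lee_fin; apply: le_trans.
apply: mean_le => zs; rewrite mem_enum => zsD.
apply: le_trans (hA N _ N0) _.
rewrite lee_fin lerD2r.
under eq_bigr do rewrite uE.
exact: (dual_energy_le gamma01 M2 eta01 selP l2 la NM zsD u0 u1).
Qed.

Theorem theorem3p6 (R : realType) :
  exists C : R -> R -> R,
    (forall lambda delta : R, 0 < C lambda delta) /\
    forall (d : nat) (alpha : R) (gamma : nat -> R) (r M : nat) (eta : R)
           (sel : forall N : nat, r.-tuple (d.-tuple 'I_N) -> 'I_r),
      (1 <= d)%N ->
      2^-1 < alpha ->
      (forall j : nat, 0 <= gamma j <= 1) ->
      (1 <= r)%N ->
      (2 <= M)%N ->
      0 < eta < 1 ->
      selects_best M alpha gamma sel ->
      inf [set 2 * korobov_prod d alpha gamma lambda | lambda in `[2^-1, alpha[]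
        <= (1 - eta) * M%:R ->
      forall lambda delta : R,
        2^-1 <= lambda < alpha ->
        0 < delta <= alpha^-1 ->
        (erms M alpha gamma sel ^+ 2 <=
          (r%:R * C lambda delta
             / (alpha * (1 - eta) `^ (lambda * (2 - delta))
                * M%:R `^ (lambda * (2 - delta) + 1))
           * korobov_prod d alpha gamma lambda `^ (lambda * (2 - delta))
           + (1 - eta) ^+ r)%:E)%E.
Proof.
have [c c0 cheb] := size_primes_in_lower R.
(* The summand 1 only keeps the constant positive for delta = 0. *)
exists (fun lambda delta => 4 `^ (lambda * (2 - delta)) * (2 * (1 + c^-1) * (`|delta|^-1 + 1))).
split.
  move=> lambda delta; apply: mulr_gt0; first exact: powR_gt0.
  apply: mulr_gt0; first by rewrite mulr_gt0// addr_gt0// invr_gt0.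
  by apply: ltr_wpDl; rewrite ?invr_ge0.
move=> d alpha gamma r M eta sel _ _ gamma01 _ M2 eta01 selP _ lambda delta
  /andP[l2 la] /andP[d0 dalpha].
have l0 : 0 < lambda by apply: lt_le_trans l2; rewrite invr_gt0.
have alpha0 : 0 < alpha by exact: lt_trans la.
have ad : alpha * delta <= 1 by rewrite -ler_pdivlMl// mulr1.
set V := korobov_prod d alpha gamma lambda.
have V1 : 1 <= V := korobov_prod_ge1 d gamma01 l0 la.
have eta1 : 0 < 1 - eta by have /andP[_] := eta01; rewrite subr_gt0.
have M0 : 0 < M%:R :> R by rewrite ltr0n; apply: leq_trans M2.
set p := lambda * (2 - delta).
set C := 4 `^ p * _; set X := (_ + _)%R.
have C0 : 0 <= C.
  apply: mulr_ge0; first exact: powR_ge0.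
  apply: mulr_ge0; first by rewrite mulr_ge0// addr_ge0// invr_ge0 ltW.
  by rewrite addr_ge0// invr_ge0.
have X0 : 0 <= X.
  rewrite addr_ge0 ?exprn_ge0 ?(ltW eta1)// mulr_ge0 ?powR_ge0//.
  apply: divr_ge0; first exact: mulr_ge0.
  by rewrite !mulr_ge0 ?powR_ge0 ?(ltW alpha0).
have bound f : unit_ball alpha gamma f -> (mean_sqr_error M sel f <= X%:E)%E.
  move=> uf.
  apply: le_trans (mean_sqr_error_le gamma01 M2 eta01 selP l2 la d0 ad c0 (cheb M M2) uf) _.
  rewrite lee_fin addrC /X lerD2r -powRrM -/p -/V.
  have -> : (4 * V / ((1 - eta) * M%:R)) `^ p =
      4 `^ p * V `^ p / ((1 - eta) `^ p * M%:R `^ p).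
    rewrite powRM ?mulr_ge0 ?invr_ge0 ?mulr_ge0 ?(ltW eta1) ?(ltW M0) ?(le_trans ler01 V1)//.
    rewrite powRM ?(le_trans ler01 V1)//; congr (_ * _).
    have EM : 0 <= (1 - eta) * M%:R by rewrite mulr_ge0 ?(ltW eta1) ?(ltW M0).
    by rewrite -[_^-1](powR_inv1 EM) -powRrM mulN1r powRN powRM ?(ltW eta1) ?(ltW M0).
  have -> : M%:R `^ (p + 1) = M%:R `^ p * M%:R :> R.
    by rewrite powRD ?powRr1 ?(ltW M0)// (gt_eqF M0) implybT.
  have Mp : 0 < M%:R `^ p :> R by rewrite powR_gt0.
  have Ep : 0 < (1 - eta) `^ p by rewrite powR_gt0.
  rewrite /C (gtr0_norm d0).
  have -> : r%:R * (4 `^ p * (2 * (1 + c^-1) * (delta^-1 + 1))) /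
        (alpha * (1 - eta) `^ p * (M%:R `^ p * M%:R)) * V `^ p =
      r%:R * (4 `^ p * V `^ p / ((1 - eta) `^ p * M%:R `^ p) *
        (2 * (1 + c^-1) / (alpha * delta * M%:R))) +
      r%:R * 4 `^ p * (2 * (1 + c^-1)) / (alpha * (1 - eta) `^ p * (M%:R `^ p * M%:R)) * V `^ p.
    by field; rewrite !gt_eqF.
  rewrite lerDl mulr_ge0 ?powR_ge0// divr_ge0//.
    by rewrite !mulr_ge0 ?powR_ge0 ?addr_ge0 ?invr_ge0 ?(ltW c0).
  by rewrite !mulr_ge0 ?powR_ge0 ?(ltW alpha0) ?(ltW M0).
have e0 : (0 <= erms M alpha gamma sel)%E.
  apply: le_trans (sqrte_ge0 _) (ereal_sup_ubound _).
  by exists (cst 0); first exact: zero_unit_ball.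
have eX : (erms M alpha gamma sel <= sqrte X%:E)%E.
  apply: ge_ereal_sup => _ [f uf <-]; rewrite lee_sqrt ?lee_fin//.
  exact: bound.
rewrite -[leRHS](sqr_sqrte _) ?lee_fin//.
by rewrite !expe2; apply: lee_pmul.
Qed.
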